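(* Let $G=(V,E)$ be a matching-covered graph with an ear decomposition $G_0\subset G_1\subset\cdots\subset G_r=G$, where $r\ge 1$. Then: (i) if $\mathcal{N}^*(G_{r-1})=\emptyset$ and $\epsilon(G_{r-1},G_r)=1$, then $\mathcal{N}^*(G)=\emptyset$; (ii) if $\sum_{1\le i\le r}\epsilon(G_{i-1},G_i)\le r+1$, then $\mathcal{N}^*(G)=\emptyset$; (iii) if $\sum_{1\le i\le r}\epsilon(G_{i-1},G_i)\ge r+2$ and $\epsilon(G_{r-1},G_r)=2$, then $\mathcal{N}^*(G)\neq\emptyset$; (iv) if $\sum_{1\le i\le r}\epsilon(G_{i-1},G_i)\ge r+2$ and $\epsilon(G_{r-1},G_r)=1$, then $\mathcal{N}^*(G)=\emptyset$ if and only if, for each $X\in\mathcal{N}^*(G_{r-1})$, the set $X\cap E(G_{r-1}-\{u,v\})$ is feasible in the graph $G_{r-1}-\{u,v\}$, where $u,v$ are the two ends of the single ear $P_r$ added to $G_{r-1}$ to obtain $G_r$.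
   Context: Graphs are finite, undirected and loopless. A graph $H$ is matching-covered if it is connected and every edge lies in some perfect matching of $H$. For any graph $H$ and $X\subseteq E(H)$, $X$ is feasible in $H$ if there are perfect matchings $M_1,M_2$ of $H$ with $|M_1\cap X|\not\equiv|M_2\cap X|\pmod 2$, and non-feasible otherwise. For $V_0\subseteq V(H)$, $\nabla_H(V_0)$ is the set of edges with exactly one end in $V_0$; $X\sim_H Y$ means $X=Y\oplus\nabla_H(V_0)$ for some $V_0\subseteq V(H)$ ($\oplus$ = symmetric difference). For a matching-covered $H$, $\mathcal{N}^*(H)$ is the set of non-feasible $X\subseteq E(H)$ with neither $X\sim_H\emptyset$ nor $X\sim_H E(H)$. For a subgraph $G'$ of $G$, a single ear of $G'$ is a path of odd length in $G$ whose two ends lie in $G'$ and whose internal vertices are not in $G'$; a double ear is a pair of vertex-disjoint single ears. An ear decomposition of a matching-covered $G$ is a sequence $G_0\subset G_1\subset\cdots\subset G_r=G$ of matching-covered subgraphs with $G_0=K_2$ and each $G_i$ the union of $G_{i-1}$ and a single or double ear of $G_{i-1}$; $\epsilon(G_{i-1},G_i)=1$ if a single ear is added and $2$ if a double ear is added.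
   Formalization: In (iii) it is also assumed that for every double ear {P,Q} added to G_{i-1}, neither G_{i-1}∪P nor G_{i-1}∪Q is matching-covered; without this (iii) is false, e.g. for a bipartite graph built from a 4-cycle by adding two double ears. *)

(* Defs.v *)
From mathcomp Require Import all_boot.

Set Implicit Arguments.
Unset Strict Implicit.
Unset Printing Implicit Defensive.

(* Parallel edges are allowed; #|ends e| = 2 excludes loops. *)
Record mgraph := MGraph {
  vertex : finType;
  edge : finType;
  ends : edge -> {set vertex};
  card_ends : forall e, #|ends e| = 2
}.

Arguments ends {G} e : rename.

Definition symdiff (T : finType) (A B : {set T}) : {set T} :=
  (A :\: B) :|: (B :\: A).

(* A vertex set and an edge set of G; it is an actual subgraph of G when
   is_subgraph holds.  Every notion below is stated for subgraphs H of G, and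
   G itself is whole G. *)
Record subg (G : mgraph) := Subg {
  verts : {set vertex G};
  edges : {set edge G}
}.

Section Matchings.

Variable G : mgraph.
Implicit Types (H : subg G) (S : {set vertex G}) (X Y M : {set edge G}).

Definition is_subgraph H : bool :=
  [forall (e | e \in edges H), ends e \subset verts H].

Definition whole : subg G := Subg [set: vertex G] [set: edge G].

Definition del_verts H S : subg G :=
  Subg (verts H :\: S) [set e in edges H | [disjoint ends e & S]].

Definition is_K2 H : bool :=
  [&& is_subgraph H, #|verts H| == 2 & #|edges H| == 1].

Definition adjacent H : rel (vertex G) :=
  fun x y => [exists e in edges H, ends e == [set x; y]].

Definition connected H : bool :=
  (verts H != set0) &&
  [forall x in verts H, forall y in verts H, connect (adjacent H) x y].

Definition perfect_matching H M : bool :=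
  (M \subset edges H) &&
  [forall v in verts H, #|[set e in M | v \in ends e]| == 1].

Definition matching_covered H : bool :=
  connected H &&
  [forall e in edges H, exists M, perfect_matching H M && (e \in M)].

Definition feasible H X : bool :=
  [exists M1, exists M2, [&& perfect_matching H M1, perfect_matching H M2
    & odd #|M1 :&: X| != odd #|M2 :&: X|]].

Definition cut H S : {set edge G} :=
  [set e in edges H | #|ends e :&: S| == 1].

Definition switch_equiv H X Y : bool :=
  [exists S : {set vertex G}, (S \subset verts H) && (X == symdiff Y (cut H S))].

Definition Nstar H : {set {set edge G}} :=
  [set X : {set edge G} | [&& X \subset edges H, ~~ feasible H X,
    ~~ switch_equiv H X set0 & ~~ switch_equiv H X (edges H)]].

End Matchings.

Arguments whole : clear implicits.

(* The walk x0 -e1- x1 -e2- ... -ek- xk is stored as its first vertex x0 and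
   the sequence (e1, x1), ..., (ek, xk); its length is k. *)
Record walk (G : mgraph) := Walk {
  wstart : vertex G;
  wsteps : seq (edge G * vertex G)
}.

(* The ears are kept as data since they determine epsilon (see nb_ears) and the
   ends of the last ear. *)
Inductive ear (G : mgraph) :=
  | SingleEar of walk G
  | DoubleEar of walk G & walk G.

Section Ears.

Variable G : mgraph.
Implicit Types (H : subg G) (P Q : walk G) (a : ear G).

Definition wend P : vertex G := last (wstart P) (unzip2 (wsteps P)).

Definition wverts P : {set vertex G} :=
  [set z in wstart P :: unzip2 (wsteps P)].

Definition wedges P : {set edge G} := [set e in unzip1 (wsteps P)].

Definition wends P : {set vertex G} := [set wstart P; wend P].

Fixpoint walk_steps (x : vertex G) (p : seq (edge G * vertex G)) : bool :=
  if p is (e, y) :: p' then (ends e == [set x; y]) && walk_steps y p' else true.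

Definition is_path P : bool :=
  walk_steps (wstart P) (wsteps P) &&
  uniq (wstart P :: unzip2 (wsteps P)).

Definition single_ear H P : bool :=
  [&& is_path P, odd (size (wsteps P)), wends P \subset verts H
    & [disjoint wverts P :\: wends P & verts H]].

Definition double_ear H P Q : bool :=
  [&& single_ear H P, single_ear H Q & [disjoint wverts P & wverts Q]].

Definition is_ear H a : bool :=
  match a with
  | SingleEar P => single_ear H P
  | DoubleEar P Q => double_ear H P Q
  end.

Definition add_walk H P : subg G :=
  Subg (verts H :|: wverts P) (edges H :|: wedges P).

Definition add_ear H a : subg G :=
  match a with
  | SingleEar P => add_walk H P
  | DoubleEar P Q => add_walk (add_walk H P) Q
  end.

(* epsilon(H, add_ear H a) *)
Definition nb_ears a : nat := if a is SingleEar _ then 1 else 2.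

(* G_i = Gs i for i <= r, and a i is the ear added to G_(i-1) to obtain G_i for
   1 <= i <= r; other values of Gs and a are irrelevant. *)
Record ear_decomposition (r : nat) (Gs : nat -> subg G) (a : nat -> ear G)
    : Prop := EarDecomposition {
  ear_dec_K2 : is_K2 (Gs 0);
  ear_dec_subgraph : forall i, i <= r -> is_subgraph (Gs i);
  ear_dec_covered : forall i, i <= r -> matching_covered (Gs i);
  ear_dec_ear : forall i, i < r -> is_ear (Gs i) (a i.+1);
  ear_dec_add : forall i, i < r -> Gs i.+1 = add_ear (Gs i) (a i.+1);
  ear_dec_strict : forall i, i < r -> Gs i <> Gs i.+1;
  ear_dec_whole : Gs r = whole G
}.

(* No double ear can be replaced by two successive single ears.  Without this,
   a double ear may be just two single ears added at once: a bipartite graph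
   built from an even cycle by adding disjoint single ears in pairs has many
   double ears, yet its non-feasible sets are all switching-equivalent to the
   empty set. *)
Definition irreducible_double_ears (r : nat) (Gs : nat -> subg G)
    (a : nat -> ear G) : Prop :=
  forall i P Q, i < r -> a i.+1 = DoubleEar P Q ->
    ~~ matching_covered (add_walk (Gs i) P) /\
    ~~ matching_covered (add_walk (Gs i) Q).

End Ears.

(* Main.v *)
Require Import Defs.
From mathcomp Require Import all_boot.

Set Implicit Arguments.
Unset Strict Implicit.
Unset Printing Implicit Defensive.

(* Over GF(2), X ~ c E (c = 0, 1) means that there is a vertex set S such that
   [e in X] = c + |e /\ S| for every edge e.  If G' is represented in this way and
   a path of odd length with ends u, v is added, then the representation extends
   to the path P exactly when |X /\ P| = c + [u in S] + [v in S] (mod 2), and it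
   is this equation that follows from comparing the parities of two perfect
   matchings of which only one uses the odd edges of P.  Hence a single ear
   preserves triviality.  For a double ear added to a bipartite G', whose
   non-feasible sets are all cuts, changing c amounts to switching at a colour
   class, and the equations for both paths hold for one of the two values of c,
   since G' - {u, v} has a perfect matching whenever u, v have different colours.
   For a double ear (P, Q) of a nonbipartite G' where neither P nor Q can be used
   alone, the first edges of P and Q form a nontrivial non-feasible set. *)

(** * Parities of cardinalities of intersections *)

Lemma card_setI_sum (T : finType) (A B : {set T}) :
  #|A :&: B| = \sum_(x in B) (x \in A).
Proof.
rewrite -sum1_card big_mkcond [RHS]big_mkcond; apply: eq_bigr => x _.
by rewrite inE; case: (x \in A); case: (x \in B).
Qed.

Lemma odd_sum (I : finType) (P : pred I) (F : I -> nat) :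
  odd (\sum_(i | P i) F i) = \big[addb/false]_(i | P i) odd (F i).
Proof. exact: (big_morph odd oddD). Qed.

Lemma card_setI2 (T : finType) (x y : T) (S : {set T}) :
  x != y -> #|[set x; y] :&: S| = (x \in S) + (y \in S).
Proof.
by move=> xy; rewrite setIC card_setI_sum big_setU1 ?inE //= big_set1.
Qed.

Lemma odd_card_setI2 (T : finType) (x y : T) (S : {set T}) :
  x != y -> odd #|[set x; y] :&: S| = (x \in S) (+) (y \in S).
Proof.
by move=> xy; rewrite card_setI2 // oddD !oddb.
Qed.

Lemma odd_cardU (T : finType) (A B : {set T}) (X : {set T}) :
  [disjoint A & B] ->
  odd #|(A :|: B) :&: X| = odd #|A :&: X| (+) odd #|B :&: X|.
Proof.
move=> dAB; rewrite setIUl cardsU oddB.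
  suff -> : A :&: X :&: (B :&: X) = set0 by rewrite cards0 addbF oddD.
  apply/setP=> x; rewrite !inE.
  by case: (boolP (x \in A)) => // /(disjointFr dAB) ->; rewrite andbF.
by apply: leq_trans (leq_addr _ _); rewrite subset_leq_card ?subsetIl.
Qed.

(** * Matchings covering prescribed vertex sets *)

Section Covers.

Variable G : mgraph.
Implicit Types (H : subg G) (S W Z : {set vertex G}) (X M N : {set edge G}).
Implicit Types (e f : edge G) (x y u v : vertex G) (c b : bool).

Definition deg M v := #|[set e in M | v \in ends e]|.

(** The condition ranges over all vertices: degree zero outside [W] keeps every edge of [M] inside
    [W], so unions and differences of matchings can be handled without naming a subgraph. *)
Definition covers M W := forall v, deg M v = (v \in W).

(* M is a perfect matching of H - S, with M still regarded as a set of edges of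
   the whole graph. *)
Definition pm H S M := M \subset edges H /\ covers M (verts H :\: S).

Lemma deg_sum M v : deg M v = \sum_(e in M) (v \in ends e).
Proof.
rewrite /deg -sum1_card big_mkcond [RHS]big_mkcond; apply: eq_bigr => e _.
by rewrite inE; case: (e \in M); case: (v \in ends e).
Qed.

Lemma degU M N v : [disjoint M & N] -> deg (M :|: N) v = deg M v + deg N v.
Proof.
move=> dMN; rewrite !deg_sum -bigU //=.
by apply: eq_bigl => e; rewrite !inE.
Qed.

Lemma deg_gt0 M e v : e \in M -> v \in ends e -> 0 < deg M v.
Proof. by move=> eM ve; apply/card_gt0P; exists e; rewrite inE eM. Qed.

Lemma covers_ends M W e v : covers M W -> e \in M -> v \in ends e -> v \in W.
Proof. by move=> MW eM ve; have := deg_gt0 eM ve; rewrite MW; case: (v \in W). Qed.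

Lemma covers_inj M W e f v : covers M W -> e \in M -> f \in M ->
  v \in ends e -> v \in ends f -> e = f.
Proof.
move=> MW eM fM ve vf; have := MW v; rewrite (covers_ends MW eM ve) => /eqP.
move=> /cards1P[g eq_g].
have: e \in [set g] by rewrite -eq_g inE eM.
have: f \in [set g] by rewrite -eq_g inE fM.
by rewrite !inE => /eqP-> /eqP.
Qed.

Lemma ends_neq0 e : exists x, x \in ends e.
Proof. by apply/card_gt0P; rewrite card_ends. Qed.

Lemma covers_disjoint M N W Z : covers M W -> covers N Z -> [disjoint W & Z] ->
  [disjoint M & N].
Proof.
move=> MW NZ dWZ; apply/pred0P=> e /=; apply/negP=> /andP[eM eN].
have [x xe] := ends_neq0 e.
by have := covers_ends NZ eN xe; rewrite (disjointFr dWZ (covers_ends MW eM xe)).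
Qed.

Lemma coversU M N W Z : covers M W -> covers N Z -> [disjoint W & Z] ->
  covers (M :|: N) (W :|: Z).
Proof.
move=> MW NZ dWZ v; rewrite degU ?(covers_disjoint MW NZ) // MW NZ inE.
by case: (boolP (v \in W)) => // /(disjointFr dWZ) ->.
Qed.

Lemma coversD M N W Z : covers M W -> covers N Z -> N \subset M ->
  covers (M :\: N) (W :\: Z).
Proof.
move=> MW NZ sNM v.
have dMN : [disjoint M :\: N & N] by rewrite -setI_eq0 setIDAC setDIl setDv setI0.
have eqM : M :\: N :|: N = M by rewrite setUC -{1}(setIidPr sNM) setID.
have := degU v dMN; rewrite eqM MW NZ inE.
by case: (v \in W); case: (v \in Z); case: (deg _ v) => // -[].
Qed.

Lemma covers1 e : covers [set e] (ends e).
Proof. by move=> v; rewrite deg_sum big_set1. Qed.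

(** Both sides count incidences of edges of [M] with vertices of [S], each vertex of [W] lying on
    exactly one edge of [M]. *)
Lemma handshake M W S : covers M W ->
  \sum_(e in M) #|ends e :&: S| = #|W :&: S|.
Proof.
move=> MW; under eq_bigr do rewrite card_setI_sum.
rewrite exchange_big card_setI_sum /=.
by apply: eq_bigr => v _; rewrite -MW deg_sum.
Qed.

Lemma covers_card M W : covers M W -> #|W| = #|M|.*2.
Proof.
move=> MW; rewrite -[W]setIT -(handshake _ MW).
under eq_bigr do rewrite setIT card_ends.
by rewrite sum_nat_const muln2.
Qed.

(* On H, the set X is the symmetric difference of the cut of S and, if c holds,
   the set of all edges; X may contain edges outside H. *)
Definition rep H c X S :=
  forall e, e \in edges H -> (e \in X) = c (+) odd #|ends e :&: S|.

(** Sum the equation of [rep] over [M] and apply [handshake]. As [#|M|] is half of [#|W|], the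
    parity depends on [M] only through [W]. *)
Lemma rep_parity H c X S M W : rep H c X S -> M \subset edges H -> covers M W ->
  odd #|M :&: X| = (c && odd #|M|) (+) odd #|W :&: S|.
Proof.
move=> repX sMH MW; rewrite -(handshake S MW) odd_sum setIC card_setI_sum odd_sum.
under eq_bigr => e eM do rewrite oddb (repX e (subsetP sMH e eM)).
rewrite big_split /=; congr (_ (+) _).
rewrite -sum1_card odd_sum; case: c {repX} => //=.
by rewrite big1.
Qed.

(** * Feasibility and switching in terms of [pm] and [rep] *)

Lemma pmP H M : is_subgraph H -> reflect (pm H set0 M) (perfect_matching H M).
Proof.
move=> /forall_inP subH; apply: (iffP andP) => [[sMH /forall_inP MH]|[sMH MH]];
  split => //.
  move=> v; rewrite setD0; case: (boolP (v \in verts H)) => vH.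
    by rewrite /deg (eqP (MH v vH)).
  apply/eqP; rewrite cards_eq0; apply/eqP/setP=> e; rewrite !inE; apply/negP.
  move=> /andP[/(subsetP sMH) eH ve].
  by rewrite (subsetP (subH e eH) v ve) in vH.
by apply/forall_inP=> v vH; rewrite -/(deg M v) MH setD0 vH.
Qed.

Lemma pm_del_vertsP H S M : is_subgraph H ->
  reflect (pm H S M) (perfect_matching (del_verts H S) M).
Proof.
move=> subH; have subD : is_subgraph (del_verts H S).
  apply/forall_inP=> e; rewrite inE => /andP[eH dS]; apply/subsetP=> v ve.
  by rewrite inE (disjointFr dS ve) (subsetP (forall_inP subH e eH)).
apply: (iffP (pmP _ subD)) => -[sM MH]; split => //.
- by apply: subset_trans sM _; apply/subsetP=> e; rewrite inE => /andP[].
- by move: MH; rewrite /= setD0.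
- apply/subsetP=> e eM; rewrite inE (subsetP sM) //=.
  apply/pred0P=> v /=; apply/negP=> /andP[ve].
  by have := covers_ends MH eM ve; rewrite inE => /andP[/negbTE->].
- by rewrite /= setD0.
Qed.

Lemma nfeasibleP H X : is_subgraph H ->
  reflect (forall M N, pm H set0 M -> pm H set0 N ->
             odd #|M :&: X| = odd #|N :&: X|)
          (~~ feasible H X).
Proof.
move=> subH; rewrite negb_exists; apply: (iffP forallP) => [nf M N | nf M].
  move=> /(pmP _ subH) HM /(pmP _ subH) HN; apply/eqP.
  by have := nf M; rewrite negb_exists => /forallP/(_ N); rewrite HM HN negbK.
rewrite negb_exists; apply/forallP=> N; apply/negP.
by move=> /and3P[/(pmP _ subH) HM /(pmP _ subH) HN]; rewrite (nf M N) ?eqxx.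
Qed.

Lemma nfeasible_del_vertsP H S X : is_subgraph H ->
  reflect (forall M N, pm H S M -> pm H S N -> odd #|M :&: X| = odd #|N :&: X|)
          (~~ feasible (del_verts H S) (X :&: edges (del_verts H S))).
Proof.
move=> subH; rewrite negb_exists.
have eqI M : pm H S M -> M :&: (X :&: edges (del_verts H S)) = M :&: X.
  move=> /(pm_del_vertsP _ _ subH)/andP[sM _].
  by rewrite setIA setIAC (setIidPl sM).
apply: (iffP forallP) => [nf M N HM HN | nf M].
  apply/eqP; have := nf M; rewrite negb_exists => /forallP/(_ N).
  rewrite !eqI //; have /(pm_del_vertsP _ _ subH) -> := HM.
  by have /(pm_del_vertsP _ _ subH) -> := HN; rewrite negbK.
rewrite negb_exists; apply/forallP=> N; apply/negP => /and3P[].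
move=> /(pm_del_vertsP _ _ subH) HM /(pm_del_vertsP _ _ subH) HN.
by rewrite !eqI // (nf M N) ?eqxx.
Qed.

Lemma odd_card_ends e S : odd #|ends e :&: S| = (#|ends e :&: S| == 1).
Proof.
have: #|ends e :&: S| <= 2 by rewrite -(card_ends e) subset_leq_card ?subsetIl.
by case: #|ends e :&: S| => [|[|[|k]]].
Qed.

Lemma switch_equivP H c X : is_subgraph H -> X \subset edges H ->
  reflect (exists S, rep H c X S)
          (switch_equiv H X (if c then edges H else set0)).
Proof.
move=> subH sX; apply: (iffP existsP) => [[S /andP[_ /eqP eX]]|[S repX]].
  exists S => e eH; rewrite eX !inE odd_card_ends eH.
  by case: c {eX}; rewrite ?inE ?eH; case: (_ == 1).
(* [rep] puts no bound on [S]; restricting it to the vertices of [H] preserves the cut, since edges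
   of [H] have their ends there. *)
exists (S :&: verts H); rewrite subsetIr /=; apply/eqP/setP=> e.
case: (boolP (e \in edges H)) => eH; last first.
  rewrite (contraNF (subsetP sX e) eH) !inE (negbTE eH) andbF orbF.
  by case: c {repX}; rewrite ?inE ?(negbTE eH) ?andbF.
rewrite repX // !inE setIA setIAC (setIidPl (forall_inP subH e eH)) eH.
rewrite odd_card_ends.
by case: c {repX}; rewrite ?inE ?eH; case: (_ == 1).
Qed.

Lemma feasibleI H X : feasible H (X :&: edges H) = feasible H X.
Proof.
have eqI M : perfect_matching H M -> M :&: (X :&: edges H) = M :&: X.
  by move=> /andP[sM _]; rewrite setIA setIAC (setIidPl sM).
apply: eq_existsb => M; apply: eq_existsb => N.
case: (boolP (perfect_matching H M)) => //= HM.
by case: (boolP (perfect_matching H N)) => //= HN; rewrite !eqI.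
Qed.

Lemma in_Nstar H X : is_subgraph H -> X \subset edges H -> ~~ feasible H X ->
  reflect (forall c S, ~ rep H c X S) (X \in Nstar H).
Proof.
move=> subH sX nf; rewrite inE sX nf /=.
apply: (iffP andP) => [[n0 n1] [] S repX | nrep].
- by case/(switch_equivP true subH sX): n1; exists S.
- by case/(switch_equivP false subH sX): n0; exists S.
split; apply/negP.
- by case/(switch_equivP false subH sX) => S /nrep.
- by case/(switch_equivP true subH sX) => S /nrep.
Qed.

Lemma rep_or_Nstar H X : is_subgraph H -> ~~ feasible H X ->
  (exists c S, rep H c X S) \/ X :&: edges H \in Nstar H.
Proof.
move=> subH nf.
have nfI : ~~ feasible H (X :&: edges H) by rewrite feasibleI.
have sI := subsetIr X (edges H).
case: (boolP [exists c : bool,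
    switch_equiv H (X :&: edges H) (if c then edges H else set0)]).
  case/existsP=> c /(switch_equivP c subH sI)[S repX]; left; exists c, S => e eH.
  by rewrite -repX // inE eH andbT.
rewrite negb_exists => /forallP nrep; right; apply/(in_Nstar subH sI nfI) => c S repX.
by have /negP[] := nrep c; apply/(switch_equivP c subH sI); exists S.
Qed.

(** The form in which emptiness of [Nstar] is used: [X] may be any set of edges of [G], so the same
    [X] can be followed from a subgraph to a larger one. *)
Lemma Nstar0P H : is_subgraph H ->
  Nstar H = set0 <-> forall X, ~~ feasible H X -> exists c S, rep H c X S.
Proof.
move=> subH; split=> [N0 X nf | trivX].
  by case: (rep_or_Nstar subH nf) => //; rewrite N0 inE.
apply/setP=> X; rewrite in_set0; apply/negP=> XN.
have := XN; rewrite inE => /and4P[sX nf _ _].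
have [c [S repX]] := trivX X nf.
exact: (elimT (in_Nstar subH sX nf) XN c S repX).
Qed.

End Covers.

(** * Alternate edges of a walk *)

Section Walks.

Variable G : mgraph.
Implicit Types (H : subg G) (S W Z : {set vertex G}) (X M N : {set edge G}).
Implicit Types (e f : edge G) (x y u v : vertex G) (c b : bool).
Implicit Types (p : seq (edge G * vertex G)) (P Q : walk G).

(* The edges of odd rank (for b = true) or of even rank (for b = false). *)
Fixpoint alt b p : {set edge G} :=
  if p is (e, _) :: p' then (if b then [set e] else set0) :|: alt (~~ b) p'
  else set0.

Lemma walk_edge_ends x p e v : walk_steps x p -> e \in unzip1 p ->
  v \in ends e -> v \in x :: unzip2 p.
Proof.
elim: p x => [|[f y] p IH] x //= /andP[/eqP ef wp].
rewrite inE => /predU1P[-> | ep] ve.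
  by move: ve; rewrite ef !inE => /orP[]->; rewrite ?orbT.
by rewrite in_cons (IH y) ?orbT.
Qed.

Lemma first_edge_notin x y p e : walk_steps y p -> x \notin y :: unzip2 p ->
  ends e = [set x; y] -> e \notin unzip1 p.
Proof.
move=> wp xp ee; apply: contra xp => ep.
by apply: (walk_edge_ends wp ep); rewrite ee set21.
Qed.

Lemma alt_sub b p : alt b p \subset [set e in unzip1 p].
Proof.
elim: p b => [|[e y] p IH] b /=; first exact: sub0set.
rewrite subUset; apply/andP; split.
  by case: b; rewrite ?sub0set // sub1set !inE eqxx.
by apply: subset_trans (IH _) _; apply/subsetP=> f; rewrite !inE orbC => ->.
Qed.

Lemma altU p : alt true p :|: alt false p = [set e in unzip1 p].
Proof.
elim: p => [|[e y] p IH] /=; first by apply/setP=> e; rewrite !inE.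
rewrite set0U -setUA [alt false p :|: _]setUC IH.
by apply/setP=> f; rewrite !inE.
Qed.

Lemma alt_disjoint x p : walk_steps x p -> uniq (x :: unzip2 p) ->
  [disjoint alt true p & alt false p].
Proof.
elim: p x => [|[e y] p IH] x.
  by move=> _ _; apply/pred0P=> f; rewrite /= inE.
move=> /= /andP[/eqP ee wp] /andP[xp up].
have ep := first_edge_notin wp xp ee; have := IH y wp up.
rewrite set0U -!setI_eq0 => /eqP d; rewrite setIUl [alt false p :&: _]setIC d.
rewrite setU0; apply/eqP/setP=> f; rewrite !inE; apply/negP=> /andP[/eqP->].
by move/(subsetP (alt_sub _ _)); rewrite inE (negbTE ep).
Qed.

Lemma last_notin (T : eqType) (x y : T) s : x \notin y :: s -> last y s != x.
Proof. by apply: contraNneq => <-; rewrite mem_last. Qed.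

(** An inner vertex lies on one edge of each rank parity. The two exceptions are the ends: the first
    edge has rank one and the last has rank [size p]. *)
Lemma deg_alt x p b v : walk_steps x p -> uniq (x :: unzip2 p) ->
  deg (alt b p) v = [&& v \in x :: unzip2 p, b || (v != x)
    & (b == odd (size p)) || (v != last x (unzip2 p))].
Proof.
elim: p x b => [|[e y] p IH] x b.
  rewrite /= deg_sum big_set0 inE => _ _.
  by case: b; case: (v == x).
move=> /= /andP[/eqP ee wp] /andP[xp up].
have ep := first_edge_notin wp xp ee; have {}IH := IH y (~~ b) wp up.
rewrite degU; last first.
  rewrite -setI_eq0; apply/eqP/setP=> f; rewrite !inE; apply/negP=> /andP[].
  case: (b); rewrite ?inE // => /eqP->.
  by move/(subsetP (alt_sub _ _)); rewrite inE (negbTE ep).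
have -> : deg (if b then [set e] else set0) v = b && (v \in [set x; y]).
  by case: (b); rewrite deg_sum ?big_set0 // big_set1 ee.
have lx := last_notin xp.
rewrite {}IH !inE; case: (eqVneq v x) => [->|vx] /=.
  have -> : (x == y) || (x \in unzip2 p) = false.
    by apply/negbTE; rewrite -in_cons.
  by case: (b); rewrite ?andbF //= [x == last _ _]eq_sym lx orbT.
case: (eqVneq v y) => [->|vy] /=; last first.
  by case: (b); case: (odd _); rewrite ?addn0 ?andbF ?andbT ?orbT.
have -> : (y == last y (unzip2 p)) = nilp p.
  case: (p) up => [|[f z] q] /=; first by rewrite eqxx.
  by move=> /andP[yq _]; rewrite eq_sym; apply/negbTE/last_notin.
by case: (b); case: (p) => [|[f z] q] //=; rewrite ?orbT.
Qed.

Lemma covers_alt P b : is_path P -> odd (size (wsteps P)) ->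
  covers (alt b (wsteps P)) (if b then wverts P else wverts P :\: wends P).
Proof.
move=> /andP[wP uP] oP v; rewrite (deg_alt _ _ wP uP) oP; case: b.
  by rewrite !inE /= andbT.
by rewrite /= !inE -/(wend P); case: (v == wstart P); case: (v == wend P);
   rewrite ?andbF ?andbT.
Qed.

(** Inner vertices have degree one in [M], so the choice made on the first edge propagates along the
    path. *)
Lemma alt_inv x p M : walk_steps x p -> uniq (x :: unzip2 p) ->
  M \subset [set e in unzip1 p] ->
  (forall v, v \in unzip2 p -> v != last x (unzip2 p) -> deg M v = 1) ->
  exists b, M = alt b p.
Proof.
elim: p x M => [|[e y] p IH] x M.
  move=> _ _ sM _; exists true; apply/setP=> f; rewrite inE.
  by apply/negP=> /(subsetP sM); rewrite inE.
move=> /= /andP[/eqP ee wp] /andP[xp up] sM degM.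
have ep := first_edge_notin wp xp ee.
have eqM : M = (if e \in M then [set e] else set0) :|: (M :\ e).
  apply/setP=> f; rewrite !inE; case: (eqVneq f e) => [->|fe] /=.
    by case: ifP; rewrite !inE ?eqxx.
  by case: ifP; rewrite !inE ?(negbTE fe).
have degMe v : deg M v = ((e \in M) && (v \in ends e)) + deg (M :\ e) v.
  rewrite {1}eqM degU.
    by case: (e \in M); rewrite deg_sum ?big_set0 // big_set1.
  rewrite -setI_eq0; apply/eqP/setP=> f; rewrite !inE.
  by case: (e \in M); rewrite !inE //; case: (f == e).
have sMe : M :\ e \subset [set e in unzip1 p].
  apply/subsetP=> f; rewrite !inE => /andP[fe /(subsetP sM)].
  by rewrite !inE (negbTE fe).
suff eqMe : M :\ e = alt (~~ (e \in M)) p.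
  by exists (e \in M); rewrite -eqMe.
have [b eq_b] : exists b, M :\ e = alt b p.
  apply: (IH y _ wp up sMe) => v vp vl; have := degM v.
  rewrite inE vp orbT vl degMe ee !inE.
  have -> : v == x = false.
    by apply: contraNF xp => /eqP <-; rewrite inE vp orbT.
  have -> : v == y = false.
    by move: up => /andP[yp _]; apply: contraNF yp => /eqP <-.
  by rewrite andbF add0n; apply.
(* If the remaining path is empty, both values of [b] give the empty set; otherwise [y] is an inner
   vertex, and its degree one forces [b] to be opposite to the choice made at [e]. *)
clear IH; case: p => [|[f z] q] in ep xp wp up sM sMe degM degMe eq_b *.
  by rewrite eq_b; case: (e \in M); case: (b).
have up' := up; move: up' => /= /andP[yq _].
have := degM y; rewrite /= mem_head eq_sym last_notin // degMe eq_b.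
rewrite (deg_alt _ _ wp up) ee !inE !eqxx orbT andbT /= [y == last _ _]eq_sym.
rewrite last_notin // orbT andbT orbF.
by case: (e \in M); case: (b) => // /(_ isT isT).
Qed.

(** The vertices after [x] are put in or out of [S'] one by one, each so that the edge leading to it
    satisfies the equation; distinctness protects the earlier choices. *)
Lemma walk_ext x p c X S : walk_steps x p -> uniq (x :: unzip2 p) ->
  exists S', (forall v, v \notin unzip2 p -> (v \in S') = (v \in S)) /\
    (forall e, e \in unzip1 p -> (e \in X) = c (+) odd #|ends e :&: S'|).
Proof.
elim: p x S => [|[e y] p IH] x S; first by exists S.
move=> /= /andP[/eqP ee wp] /andP[xp up].
have xy : x != y by apply: contraNneq xp => ->; rewrite mem_head.
pose S1 := if (e \in X) (+) c (+) (x \in S) then y |: S else S :\ y.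
have S1y : (y \in S1) = (e \in X) (+) c (+) (x \in S).
  by rewrite /S1; case: ifP; rewrite !inE eqxx.
have S1v v : v != y -> (v \in S1) = (v \in S).
  by move=> vy; rewrite /S1; case: ifP; rewrite !inE ?vy // (negbTE vy).
have [S' [agr repS]] := IH y S1 wp up; exists S'; split=> [v | f].
  by rewrite inE negb_or => /andP[vy vp]; rewrite agr // S1v.
rewrite inE => /predU1P[-> | /repS //].
have yp : y \notin unzip2 p by case/andP: up.
have xp' : x \notin unzip2 p by apply: contra xp => xp; rewrite inE xp orbT.
rewrite ee odd_card_setI2 // !agr // S1y S1v //.
by case: (e \in X); case: (c); case: (x \in S).
Qed.

Lemma walk_sum x p c X S : walk_steps x p -> uniq (x :: unzip2 p) ->
  (forall e, e \in unzip1 p -> (e \in X) = c (+) odd #|ends e :&: S|) ->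
  odd #|[set e in unzip1 p] :&: X| =
    (c && odd (size p)) (+) ((x \in S) (+) (last x (unzip2 p) \in S)).
Proof.
elim: p x => [|[e y] p IH] x.
  rewrite addbb andbF => _ _ _; have -> : [set e in [::]] = set0 :> {set edge G}.
    by apply/setP=> f; rewrite !inE.
  by rewrite set0I cards0.
move=> /= /andP[/eqP ee wp] /andP[xp up] repX.
have xy : x != y by apply: contraNneq xp => ->; rewrite mem_head.
have -> : [set f in e :: unzip1 p] = [set e] :|: [set f in unzip1 p].
  by apply/setP=> f; rewrite !inE.
rewrite odd_cardU; last first.
  rewrite disjoints1 inE; exact: first_edge_notin wp xp ee.
rewrite (IH y) // => [|f fp]; last by rewrite repX // inE fp orbT.
have -> : odd #|[set e] :&: X| = (e \in X).
  by rewrite setIC card_setI_sum big_set1 oddb.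
rewrite repX ?mem_head // ee odd_card_setI2 //.
by case: (c); case: (odd _); case: (_ \in S); case: (_ \in S);
   case: (_ \in S).
Qed.

End Walks.

(** * Matchings and representations after adding an ear *)

Section AddWalk.

Variable G : mgraph.
Variables (H : subg G) (P : walk G).
Hypotheses (subH : is_subgraph H) (earP : single_ear H P).
Implicit Types (S : {set vertex G}) (X M N : {set edge G}).

Let pathP : is_path P. Proof. by case/and4P: earP. Qed.
Let oddP : odd (size (wsteps P)). Proof. by case/and4P: earP. Qed.
Let walkP : walk_steps (wstart P) (wsteps P). Proof. by case/andP: pathP. Qed.
Let uniqP : uniq (wstart P :: unzip2 (wsteps P)).
Proof. by case/andP: pathP. Qed.

Lemma ear_ends_neq : wstart P != wend P.
Proof.
move: uniqP oddP; rewrite /wend; case: (wsteps P) => [|[e y] p] //= /andP[xp _] _.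
by rewrite eq_sym last_notin.
Qed.

Lemma ear_ends_sub v : v \in wends P -> (v \in wverts P) && (v \in verts H).
Proof.
move=> vP; case/and4P: earP => _ _ /subsetP/(_ v vP)-> _; rewrite andbT inE.
by move: vP; rewrite !inE => /orP[] /eqP->; rewrite ?eqxx // -in_cons mem_last.
Qed.

Lemma ear_meet v : v \in wverts P -> v \in verts H -> v \in wends P.
Proof.
case/and4P: earP => _ _ _ dP vP vH; apply: contraTT vH => vE.
by rewrite (disjointFr dP) // inE vE.
Qed.

Lemma wedges_ends e v : e \in wedges P -> v \in ends e -> v \in wverts P.
Proof. by rewrite !inE; apply: walk_edge_ends walkP. Qed.

Lemma is_subgraph_add_walk : is_subgraph (add_walk H P).
Proof.
apply/forall_inP=> e; rewrite inE => /orP[eH | eP]; apply/subsetP=> v ve.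
  by rewrite inE (subsetP (forall_inP subH e eH)).
by rewrite inE orbC (wedges_ends eP).
Qed.

(** An edge of [P] already in [H] has both ends in [H], so it joins the two ends of [P]; the
    vertices of [P] being distinct, it is all of [P]. The definition of [single_ear] allows this
    degenerate case. *)
Lemma ear_new_or_trivial :
  [disjoint wedges P & edges H] \/ add_walk H P = H.
Proof.
case: (boolP [disjoint _ & _]) => [|/existsP[e /andP[eP eH]]]; first by left.
right; have ee : ends e = wends P.
  apply/eqP; rewrite eqEcard card_ends cards2 ear_ends_neq andbT.
  apply/subsetP=> v ve; apply: ear_meet; first exact: wedges_ends eP ve.
  exact: (subsetP (forall_inP subH e eH)).
suff [sV sE] : wverts P \subset verts H /\ wedges P \subset edges H.
  by rewrite /add_walk (setUidPl sV) (setUidPl sE); case: (H).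
have xe : wstart P \in ends e by rewrite ee set21.
have: wends P \subset verts H by case/and4P: earP.
move: walkP uniqP ee xe eP; rewrite /wends /wend /wverts /wedges.
case: (wsteps P) => [|[f y] p] /=; first by rewrite inE.
move=> /andP[/eqP ef wp] /andP[xp up] ee xe; rewrite inE => ep sV.
have ef' : e = f.
  move: ep; rewrite inE => /predU1P[// | ep].
  by case/negP: xp; apply: walk_edge_ends wp ep xe.
have: y \in ends e by rewrite ef' ef set22.
rewrite ee !inE => /orP[/eqP yx | yl]; first by rewrite yx mem_head in xp.
have p0 : p = [::].
  case: (p) up yl => [//|[g z] q] /= /andP[yq _].
  by rewrite eq_sym (negbTE (last_notin yq)).
move: sV; rewrite p0 /= => sV.
split; last by apply/subsetP=> g; rewrite !inE -ef' => /eqP->.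
by apply: subset_trans sV; apply/subsetP=> v; rewrite !inE.
Qed.

Lemma ear_bool v S : S \subset verts H -> [disjoint S & wverts P] ->
  [&& (v \in wends P) ==> (v \in wverts P) && (v \in verts H),
      (v \in wverts P) && (v \in verts H) ==> (v \in wends P)
    & (v \in S) ==> (v \in verts H) && (v \notin wverts P)].
Proof.
move=> sS dS; apply/and3P; split; apply/implyP.
- exact: ear_ends_sub.
- by case/andP; apply: ear_meet.
- by move=> vS; rewrite (subsetP sS) // (disjointFr dS).
Qed.

(** The odd-rank edges ([b] true) cover the ends of [P] as well, the even-rank edges only its
    interior. [S] makes room for a second ear, whose ends it may contain. *)
Lemma pm_add_walk S b N : S \subset verts H -> [disjoint S & wverts P] ->
  pm H (S :|: (if b then wends P else set0)) N ->
  pm (add_walk H P) S (N :|: alt b (wsteps P)).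
Proof.
move=> sS dS [sN HN]; split.
  by apply: setUSS sN _; apply: alt_sub.
have HP := covers_alt b pathP oddP.
suff [d <-] : [disjoint verts H :\: (S :|: (if b then wends P else set0)) &
    if b then wverts P else wverts P :\: wends P] /\
  verts H :\: (S :|: (if b then wends P else set0)) :|:
    (if b then wverts P else wverts P :\: wends P) =
  verts (add_walk H P) :\: S.
  exact: coversU HN HP d.
have bE v : v \in (if b then wends P else set0) = b && (v \in wends P).
  by case: (b); rewrite ?inE.
have bV v : v \in (if b then wverts P else wverts P :\: wends P) =
    (v \in wverts P) && (b || (v \notin wends P)).
  by case: (b); rewrite ?inE ?andbT // andbC.
split.
  apply/pred0P=> v /=; rewrite in_setD in_setU bE bV.
  have := @ear_meet v; case: (v \in wverts P); case: (v \in verts H);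
    rewrite ?andbF // => /(_ isT isT) ->.
  by case: (b); rewrite ?orbT ?andbF.
apply/setP=> v; rewrite in_setU !in_setD !in_setU bE bV.
by have := ear_bool v sS dS; case: (v \in S); case: (v \in verts H);
   case: (v \in wverts P); case: (v \in wends P); case: (b).
Qed.

Lemma pm_add_walk_inv S M : S \subset verts H -> [disjoint S & wverts P] ->
  pm (add_walk H P) S M -> exists b, exists2 N,
    pm H (S :|: (if b then wends P else set0)) N & M = N :|: alt b (wsteps P).
Proof.
move=> sS dS [sM HM].
have [b eq_b] : exists b, M :&: wedges P = alt b (wsteps P).
  (* An inner vertex of [P] lies outside [H], so the edge of [M] at it belongs to [P]. *)
  apply: alt_inv walkP uniqP (subsetIr _ _) _ => v vP vl.
  have vW : v \in wverts P by rewrite !inE vP orbT.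
  have vH : v \notin verts H.
    apply/negP=> /(ear_meet vW); rewrite !inE (negbTE vl) orbF => /eqP vx.
    by move: uniqP; rewrite -vx /= vP.
  have := HM v; rewrite in_setD /= in_setU vW orbT andbT.
  have -> : v \notin S by rewrite (contraNN (subsetP sS v)).
  move=> deg1; apply: etrans deg1.
  apply: eq_card => e; rewrite !inE.
  case: (boolP (e \in M)) => //= eM; case: (boolP (v \in ends e)) => ve;
    rewrite ?andbF // andbT.
  move: (subsetP sM e eM); rewrite !inE => /orP[eH | ->] //.
  by rewrite (subsetP (forall_inP subH e eH)) in vH.
have sA : alt b (wsteps P) \subset M by rewrite -eq_b subsetIl.
exists b, (M :\: alt b (wsteps P)); last first.
  by rewrite setUC -{1}(setIidPr sA) setID.
split.
  apply/subsetP=> e; rewrite -eq_b !inE => /andP[+ eM].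
  by rewrite eM /=; move: (subsetP sM e eM); rewrite !inE => /orP[] ->.
have := coversD HM (covers_alt b pathP oddP) sA.
set W := (W in covers _ W); move=> HW v; rewrite HW {HW}/W.
have bE : v \in (if b then wends P else set0) = b && (v \in wends P).
  by case: (b); rewrite ?inE.
have bV : v \in (if b then wverts P else wverts P :\: wends P) =
    (v \in wverts P) && (b || (v \notin wends P)).
  by case: (b); rewrite ?inE ?andbT // andbC.
rewrite !in_setD !in_setU bE bV.
by have := ear_bool v sS dS; case: (v \in S); case: (v \in verts H);
   case: (v \in wverts P); case: (v \in wends P); case: (b).
Qed.

(** Extending along [P] could alter [S] at the far end of [P]; the equation for the sum over [P]
    makes the new set agree with [S] there. *)
Lemma rep_add_walk c X S : rep H c X S ->
  odd #|wedges P :&: X| = c (+) odd #|wends P :&: S| ->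
  exists2 S' : {set vertex G}, (forall v, v \in verts H -> (v \in S') = (v \in S))
            & rep (add_walk H P) c X S'.
Proof.
move=> repX; rewrite odd_card_setI2 ?ear_ends_neq // => sumX.
have [S' [agr repS]] := walk_ext c X S walkP uniqP.
have := walk_sum walkP uniqP repS; rewrite -/(wedges P) sumX oddP andbT.
move=> /addbI; rewrite -/(wend P).
have x1 : wstart P \notin unzip2 (wsteps P) by case/andP: uniqP.
rewrite (agr _ x1) => /addbI lastS.
have agrH v : v \in verts H -> (v \in S') = (v \in S).
  move=> vH; case: (boolP (v \in unzip2 (wsteps P))) => [vP | /agr //].
  have vW : v \in wverts P by rewrite !inE vP orbT.
  have := ear_meet vW vH; rewrite !inE => /orP[] /eqP-> //; exact: agr.
exists S' => // e; rewrite inE => /orP[eH | eP]; last first.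
  by apply: repS; move: eP; rewrite inE.
rewrite repX //; congr (_ (+) odd _); apply: eq_card => v; rewrite !inE.
case: (boolP (v \in ends e)) => //= ve; apply/esym/agrH.
exact: (subsetP (forall_inP subH e eH)).
Qed.

Lemma rep_add_walk_sum c X S : rep (add_walk H P) c X S ->
  odd #|wedges P :&: X| = c (+) odd #|wends P :&: S|.
Proof.
move=> repX; rewrite odd_card_setI2 ?ear_ends_neq //.
rewrite (walk_sum walkP uniqP (c := c) (S := S)) ?oddP ?andbT // => e eP.
by apply: repX; rewrite !inE eP orbT.
Qed.

End AddWalk.

(** * Bipartite matching-covered graphs *)

Section Covered.

Variable G : mgraph.
Implicit Types (H : subg G) (S T W Z : {set vertex G}) (X M N : {set edge G}).
Implicit Types (e f m : edge G) (x y u v a b : vertex G).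
Implicit Types (P Q : walk G).

Lemma covered_edge H e : is_subgraph H -> matching_covered H -> e \in edges H ->
  exists2 M, pm H set0 M & e \in M.
Proof.
move=> subH /andP[_ /forall_inP covH] /covH/existsP[M /andP[/(pmP _ subH) HM eM]].
by exists M.
Qed.

(** [rep H false setT T] says that [H] is bipartite with colour class [T]: an odd number of ends in
    [T] means exactly one. *)
Lemma bip_ends H T e : rep H false setT T -> e \in edges H ->
  exists a b : vertex G, [/\ ends e = [set a; b], a \in T & b \notin T].
Proof.
move=> bipT eH; have := card_ends e; move=> /eqP/cards2P[x [y [xy ee]]].
have := bipT e eH; rewrite inE ee odd_card_setI2 //=.
case: (boolP (x \in T)); case: (boolP (y \in T)) => //= yT xT _.
  by exists x, y.
by exists y, x; rewrite setUC.
Qed.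

Section Bipartite.

Variables (H : subg G) (T : {set vertex G}) (M : {set edge G}).
Hypotheses (subH : is_subgraph H) (covH : matching_covered H).
Hypotheses (bipT : rep H false setT T) (HM : pm H set0 M).

Let MV : covers M (verts H). Proof. by case: HM => _; rewrite setD0. Qed.
Let sM : M \subset edges H. Proof. by case: HM. Qed.

(** An edge of [M] and a following edge of [H] form one step between vertices outside [T], so that
    alternating paths are paths of a relation and can be shortened to simple ones. *)
Definition altstep x y := [exists a, exists m, exists f,
  [&& m \in M, f \in edges H, [&& a \in T, x \notin T & y \notin T],
      ends m == [set x; a] & ends f == [set a; y]]].

Lemma altstepP x y : reflect (exists a m f, [/\ m \in M, f \in edges H,
    [/\ a \in T, x \notin T & y \notin T], ends m = [set x; a] & ends f = [set a; y]])
  (altstep x y).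
Proof.
apply: (iffP existsP) => [[a /existsP[m /existsP[f]]]|[a [m [f]]]].
  by case/and5P=> mM fH /and3P[aT xT yT] /eqP em /eqP ef; exists a, m, f.
case=> mM fH [aT xT yT] em ef; exists a; apply/existsP; exists m.
by apply/existsP; exists f; rewrite mM fH aT xT yT em ef !eqxx.
Qed.

(* Exchanging the edges of M along an M-alternating path; the last clause keeps
   the edges of M used by the earlier part of the path. *)
Lemma flip_path u m x p : u \in T -> m \in M -> ends m = [set last x p; u] ->
  x \notin T -> path altstep x p -> uniq (x :: p) ->
  exists N, [/\ N \subset edges H, covers N (verts H :\: [set u; x])
    & forall e, e \in M ->
        (forall z, z \in x :: p -> z \notin T -> z \notin ends e) -> e \in N].
Proof.
move=> uT mM; elim: p x => [|y p IH] x /= em xT.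
  exists (M :\ m); split; first exact: subset_trans (subD1set _ _) sM.
    by rewrite setUC -em; apply: coversD (covers1 m) _; rewrite ?sub1set.
  move=> e eM notx; rewrite !inE eM andbT.
  apply: contraL (set21 x u) => /eqP eqm.
  by rewrite -em -eqm notx ?mem_head.
move=> /andP[/altstepP[a [m0 [f [m0M fH [aT _ yT] em0 ef]]]] yp] /andP[xp up].
have [N1 [sN1 N1V agr]] := IH y em yT yp up.
(* The exchange so far concerns the path from [y] on; [m0] contains none of its vertices outside [T]
   and is still present. *)
have m0N : m0 \in N1.
  apply: agr => // z zp zT; rewrite em0 !inE negb_or.
  apply/andP; split; first by apply: contraNneq xp => <-.
  by apply: contraNneq zT => ->.
have aN : a \in verts H :\: [set u; y].
  by apply: covers_ends N1V m0N _; rewrite em0 set22.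
have xN : x \in verts H :\: [set u; y].
  by apply: covers_ends N1V m0N _; rewrite em0 set21.
have yH : y \in verts H.
  by apply: (subsetP (forall_inP subH f fH)); rewrite ef set22.
(* [N1] misses [u] and [y]; trading [m0], with ends [x] and [a], for [f], with ends [a] and [y],
   covers [y] and uncovers [x]. *)
exists (N1 :\ m0 :|: [set f]); split.
- rewrite subUset sub1set fH andbT.
  exact: subset_trans (subD1set _ _) sN1.
- have sub1 : [set m0] \subset N1 by rewrite sub1set.
  have xa : x != a by apply: contraNneq xT => ->.
  have ya : y != a by apply: contraNneq yT => ->.
  move: aN xN; rewrite !inE !negb_or => /andP[/andP[au _] aH] /andP[/andP[xu xy] xH].
  have yu : y != u by apply: contraNneq yT => ->.
  suff [d <-] : [disjoint verts H :\: [set u; y] :\: ends m0 & ends f] /\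
      verts H :\: [set u; y] :\: ends m0 :|: ends f = verts H :\: [set u; x].
    exact: coversU (coversD N1V (covers1 m0) sub1) (covers1 f) d.
  rewrite em0 ef; split.
    apply/pred0P=> z; rewrite /= !inE; case: (z == y); rewrite ?orbT ?andbF //.
    by case: (z == a); rewrite ?orbT ?andbF.
  apply/setP=> z; rewrite !inE.
  case: (eqVneq z a) => [->|za]; first by rewrite aH (negbTE au) eq_sym (negbTE xa) orbT.
  case: (eqVneq z y) => [->|zy].
    by rewrite yH (negbTE yu) eq_sym (negbTE xy) !orbT.
  by case: (z == u); case: (z == x); rewrite ?orbF ?andbF ?andbT.
move=> e eM note; rewrite !inE agr ?andbT //=.
  rewrite (_ : e != m0) //; apply: contraL (set21 x a) => /eqP em0'.
  by rewrite -em0 -em0' note ?mem_head.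
by move=> z zp; apply: note; rewrite inE zp orbT.
Qed.

(** [Rb] is the set of vertices reachable from [v] by alternating steps, [Ra] that of their partners
    in [M]. Edges at [Ra] lead into [Rb]; counting over perfect matchings turns this into an
    equivalence on every edge. So the union of [Ra] and [Rb] is closed under adjacency and contains
    [u], and an alternating path from [v] to the partner of [u] can be exchanged. *)
Lemma bip_pm u v : u \in verts H -> v \in verts H -> u \in T -> v \notin T ->
  exists N, pm H [set u; v] N.
Proof.
move=> uH vH uT vT.
pose Rb := [set b | (b \notin T) && connect altstep v b].
pose Ra := [set a in T | [exists m in M, exists b in Rb, ends m == [set b; a]]].
have RaP a : reflect (a \in T /\ exists m b, [/\ m \in M, b \in Rb & ends m = [set b; a]])
    (a \in Ra).
  rewrite inE; apply: (iffP andP) => -[aT].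
    by case/existsP=> m /andP[mM /existsP[b /andP[bR /eqP em]]]; split=> //; exists m, b.
  case=> m [b [mM bR em]]; split=> //; apply/existsP; exists m; rewrite mM.
  by apply/existsP; exists b; rewrite bR em eqxx.
have notRb a : a \in T -> a \notin Rb by move=> aT; rewrite inE aT.
have notRa b : b \notin T -> b \notin Ra.
  by move=> bT; rewrite inE (negbTE bT).
have cntE e : e \in edges H -> exists a b, [/\ ends e = [set a; b], a \in T,
    b \notin T & #|ends e :&: Ra| = (a \in Ra) /\ #|ends e :&: Rb| = (b \in Rb)].
  move=> eH; have [a [b [ee aT bT]]] := bip_ends bipT eH.
  have ab : a != b by apply: contraNneq bT => <-.
  exists a, b; split => //; rewrite ee !card_setI2 //.
  by rewrite (negbTE (notRa b bT)) (negbTE (notRb a aT)) addn0 add0n.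
have cntM e : e \in M -> #|ends e :&: Ra| = #|ends e :&: Rb|.
  move=> eM; have [a [b [ee aT bT [-> ->]]]] := cntE e (subsetP sM e eM).
  congr (nat_of_bool _); apply/RaP/idP => [[_ [m [b0 [mM b0R em]]]] | bR].
    have eqm : m = e by apply: (covers_inj (v := a) MV mM eM); rewrite ?em ?ee !inE eqxx ?orbT.
    have : b0 \in ends e by rewrite -eqm em set21.
    rewrite ee in_set2 => /orP[] /eqP eb; last by rewrite -eb.
    by rewrite eb (negbTE (notRb a aT)) in b0R.
  by split=> //; exists e, b; rewrite setUC.
have cntle e : e \in edges H -> #|ends e :&: Ra| <= #|ends e :&: Rb|.
  move=> eH; have [a [b [ee aT bT [-> ->]]]] := cntE e eH.
  case: RaP => // -[_ [m [b0 [mM]]]]; rewrite [b0 \in _]inE => /andP[b0T b0R] em.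
  suff -> : b \in Rb by [].
  rewrite inE bT; apply: connect_trans b0R (connect1 _).
  by apply/altstepP; exists a, m, e.
have sumeq : #|verts H :&: Ra| = #|verts H :&: Rb|.
  by rewrite -!(handshake _ MV); apply: eq_bigr => e /cntM.
have cnt e : e \in edges H -> #|ends e :&: Ra| = #|ends e :&: Rb|.
  move=> eH; have [M' [sM' M'V] eM'] := covered_edge subH covH eH.
  rewrite setD0 in M'V.
  (* The two sums over [M'] are equal, so the termwise inequality is an equality at each edge of
     [M'], in particular at [e]. *)
  have := leqif_sum (fun f (fM' : f \in M') =>
    leqif_eq (cntle f (subsetP sM' f fM'))).
  rewrite !(handshake _ M'V) sumeq => /leqifP; case: ifP; last by rewrite ltnn.
  by move=> /forall_inP/(_ e eM')/eqP.
have clos : closed (adjacent H) (mem (Ra :|: Rb)).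
  move=> x y /existsP[e /andP[eH /eqP exy]].
  have [a [b [ee aT bT [ca cb]]]] := cntE e eH.
  have : (a \in Ra) = (b \in Rb).
    by have := cnt e eH; rewrite ca cb; case: (a \in Ra); case: (b \in Rb).
  have aZ : (a \in Ra :|: Rb) = (a \in Ra) by rewrite inE (negbTE (notRb a aT)) orbF.
  have bZ : (b \in Ra :|: Rb) = (b \in Rb) by rewrite inE (negbTE (notRa b bT)).
  rewrite -aZ -bZ => abZ.
  have : x \in ends e by rewrite exy set21.
  have : y \in ends e by rewrite exy set22.
  by rewrite ee !in_set2 => /orP[] /eqP-> /orP[] /eqP->; rewrite ?abZ.
have: u \in Ra.
  have uv : connect (adjacent H) v u.
    by case/andP: covH => /andP[_ /forall_inP/(_ v vH)/forall_inP/(_ u uH)].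
  have uZ : u \in Ra :|: Rb.
    rewrite -[_ \in _](closed_connect clos uv).
    by rewrite !inE vT connect0 orbT.
  by move: uZ; rewrite inE (negbTE (notRb u uT)) orbF.
case/RaP=> _ [m [b [mM bR em]]].
move: bR; rewrite inE => /andP[bT /connectP[p vp bp]].
move: em; rewrite {}bp; case/shortenP: vp => q vq uq _ em.
have [N [sN NV _]] := flip_path uT mM em vT vq uq.
by exists N.
Qed.

End Bipartite.

End Covered.

(** * Single ears *)

Section Ears.

Variable G : mgraph.
Implicit Types (H : subg G) (S T W Z : {set vertex G}) (X M N : {set edge G}).
Implicit Types (e f : edge G) (x y u v : vertex G) (c b : bool).
Implicit Types (P Q : walk G).

Lemma bip_pm_ear H T M P : is_subgraph H -> matching_covered H ->
  rep H false setT T -> pm H set0 M -> single_ear H P ->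
  odd #|wends P :&: T| -> exists N, pm H (wends P) N.
Proof.
move=> subH covH bipT HM earP; rewrite odd_card_setI2 ?(ear_ends_neq earP) //.
have /andP[_ sH] := ear_ends_sub earP (set21 (wstart P) (wend P)).
have /andP[_ eH] := ear_ends_sub earP (set22 (wstart P) (wend P)).
case: (boolP (_ \in T)) => sT; case: (boolP (_ \in T)) => eT //= _.
  exact: (bip_pm subH covH bipT HM sH eH sT eT).
have [N HN] := bip_pm subH covH bipT HM eH sH eT sT.
by exists N; rewrite /wends setUC.
Qed.

Lemma card_deficit H S M N : S \subset verts H -> pm H set0 M -> pm H S N ->
  odd #|S|./2 = odd #|M| (+) odd #|N|.
Proof.
move=> sS [_ MV] [_ NV]; have := covers_card MV; rewrite setD0.
rewrite -(cardsID S) (setIidPr sS) (covers_card NV) => eqM.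
have -> : #|M| = #|S|./2 + #|N|.
  by rewrite -[#|M|]doubleK -eqM halfD odd_double andbF add0n doubleK.
by rewrite oddD addbK.
Qed.

(** Leaving [S1] uncovered costs [#|S1|./2] edges, each contributing [c], and the share of the
    vertices in [S1]. *)
Lemma rep_parity_deficit H c X S S1 M N : rep H c X S -> S1 \subset verts H ->
  pm H set0 M -> pm H S1 N ->
  odd #|N :&: X| = odd #|M :&: X| (+) (c && odd #|S1|./2) (+) odd #|S1 :&: S|.
Proof.
move=> repX sS HM HN; rewrite (card_deficit sS HM HN).
case: HM HN => sM MV [sN NV].
rewrite (rep_parity repX sM MV) (rep_parity repX sN NV) setD0.
have -> : odd #|verts H :&: S| = odd #|(verts H :\: S1) :&: S| (+) odd #|S1 :&: S|.
  rewrite -{1}(setID (verts H) S1) (setIidPr sS) setUC odd_cardU //.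
  by rewrite -setI_eq0 setIDAC setDIl setDv setI0.
case: c {repX}; case: (odd #|M|); case: (odd #|N|);
  by case: (odd _); case: (odd _).
Qed.

Lemma odd_alt H P b X : single_ear H P ->
  odd #|alt b (wsteps P) :&: X| =
    odd #|alt false (wsteps P) :&: X| (+) (b && odd #|wedges P :&: X|).
Proof.
case/and4P=> /andP[wP uP] _ _ _; rewrite /wedges -altU.
rewrite odd_cardU; last exact: alt_disjoint wP uP.
by case: b; rewrite ?addbF // addbCA addbb addbF.
Qed.

(** The first edge has odd rank; its presence in a perfect matching reveals which alternate set of
    [P] is used. *)
Lemma ear_first_edge H P : single_ear H P ->
  exists2 f, f \in wedges P & forall b, (f \in alt b (wsteps P)) = b.
Proof.
case/and4P=> /andP[wP uP] oP _ _; have := alt_disjoint wP uP.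
case eP: (wsteps P) oP => [//|[f y] p] _ d; exists f.
  by rewrite inE eP mem_head.
case; first by rewrite /= !inE eqxx.
by rewrite (disjointFr d) // /= !inE eqxx.
Qed.

Lemma alt_wedges P b : alt b (wsteps P) \subset wedges P.
Proof. exact: alt_sub. Qed.

Lemma alt_wedgesT P e : e \in wedges P -> exists b, e \in alt b (wsteps P).
Proof. by rewrite /wedges -altU => /setUP[]; [exists true | exists false]. Qed.

Lemma disjoint_alt H P N b : [disjoint wedges P & edges H] -> N \subset edges H ->
  [disjoint N & alt b (wsteps P)].
Proof.
move=> newP sN; rewrite disjoint_sym.
apply: disjointWl (alt_wedges P b) _; exact: disjointWr sN newP.
Qed.

Lemma connect_walk H x p v : walk_steps x p ->
  [set e in unzip1 p] \subset edges H -> v \in x :: unzip2 p ->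
  connect (adjacent H) x v.
Proof.
elim: p x => [|[e y] p IH] x /=; first by move=> _ _; rewrite inE => /eqP->.
move=> /andP[/eqP ee wp] /subsetP sp; rewrite inE => /predU1P[-> // | vp].
apply: (connect_trans (y := y)); last first.
  by apply: IH => //; apply/subsetP=> f; rewrite inE => fp; apply: sp; rewrite !inE fp orbT.
apply: connect1; apply/existsP; exists e; rewrite ee eqxx andbT.
by apply: sp; rewrite !inE eqxx.
Qed.

Lemma adjacent_sym H : connect_sym (adjacent H).
Proof.
apply: sym_connect_sym => x y; apply: eq_existsb => e.
by rewrite [[set x; y]]setUC.
Qed.

Lemma connected_add_walk H P : is_subgraph H -> single_ear H P -> connected H ->
  connected (add_walk H P).
Proof.
move=> subH earP /andP[_ /forall_inP conH].
have /andP[_ sH] := ear_ends_sub earP (set21 (wstart P) (wend P)).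
have sE : edges H \subset edges (add_walk H P) by apply: subsetUl.
have toS v : v \in verts (add_walk H P) ->
    connect (adjacent (add_walk H P)) (wstart P) v.
  case/setUP=> [vH | ]; last first.
    rewrite inE; apply: connect_walk; last exact: subsetUr.
    by case/and4P: earP => /andP[].
  apply: connect_sub (forall_inP (conH _ sH) v vH) => x y.
  case/existsP=> e /andP[eH exy]; apply: connect1; apply/existsP; exists e.
  by rewrite exy (subsetP sE).
apply/andP; split; first by apply/set0Pn; exists (wstart P); rewrite inE sH.
apply/forall_inP=> x /toS xK; apply/forall_inP=> y /toS; apply: connect_trans.
by rewrite adjacent_sym.
Qed.

Section SingleEar.

Variables (H : subg G) (P : walk G) (M0 : {set edge G}).
Hypotheses (subH : is_subgraph H) (earP : single_ear H P).
Hypotheses (newP : [disjoint wedges P & edges H]) (HM0 : pm H set0 M0).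

Let K := add_walk H P.
Let subK : is_subgraph K. Proof. exact: is_subgraph_add_walk earP. Qed.

Lemma pm_single b N : pm H (if b then wends P else set0) N ->
  pm K set0 (N :|: alt b (wsteps P)).
Proof.
move=> HN; apply: pm_add_walk => //; rewrite ?sub0set ?set0U //.
by rewrite -setI_eq0 set0I.
Qed.

Lemma pm_single_inv M : pm K set0 M -> exists b, exists2 N,
  pm H (if b then wends P else set0) N & M = N :|: alt b (wsteps P).
Proof.
move=> HM; have := pm_add_walk_inv subH earP (sub0set _) _ HM.
have -> : [disjoint set0 & wverts P] by rewrite -setI_eq0 set0I.
by move=> /(_ isT)[b [N HN ->]]; exists b, N => //; rewrite set0U in HN.
Qed.

Lemma odd_single b N X : N \subset edges H ->
  odd #|(N :|: alt b (wsteps P)) :&: X| = odd #|N :&: X| (+)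
    odd #|alt false (wsteps P) :&: X| (+) (b && odd #|wedges P :&: X|).
Proof.
move=> sN; rewrite odd_cardU ?(disjoint_alt b newP sN) //.
by rewrite (odd_alt b X earP) addbA.
Qed.

Lemma nfeasible_single X : ~~ feasible K X -> ~~ feasible H X.
Proof.
move=> /(nfeasibleP _ subK) nf; apply/(nfeasibleP _ subH) => M N HM HN.
have := nf _ _ (@pm_single false M HM) (@pm_single false N HN).
rewrite !odd_single ?andbF ?addbF; try by case: HM HN => ? _ [].
exact: addIb.
Qed.

(** Old edges and even-rank edges of [P] lie in extensions of perfect matchings of [H]; the odd-rank
    edges lie in the extension of [N]. *)
Lemma matching_covered_single N : matching_covered H -> pm H (wends P) N ->
  matching_covered K.
Proof.
move=> covH HN; apply/andP; split.
  by case/andP: covH => conH _; apply: connected_add_walk.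
apply/forall_inP=> e /setUP[eH | eP].
  have [M HM eM] := covered_edge subH covH eH.
  apply/existsP; exists (M :|: alt false (wsteps P)).
  by rewrite inE eM andbT; apply/(pmP _ subK)/pm_single.
have [b eb] := alt_wedgesT eP; apply/existsP.
exists ((if b then N else M0) :|: alt b (wsteps P)); rewrite inE eb orbT andbT.
by apply/(pmP _ subK)/pm_single; case: (b).
Qed.

Lemma single_ear_pm : matching_covered K -> exists N, pm H (wends P) N.
Proof.
move=> covK; have [f fP fb] := ear_first_edge earP.
have fK : f \in edges K by rewrite inE fP orbT.
have [M HM fM] := covered_edge subK covK fK.
have [b [N HN eM]] := pm_single_inv HM; move: fM; rewrite eM inE fb.
have -> : f \in N = false.
  by case: HN => /subsetP sN _; apply/negbTE/(contraNN (@sN f)); rewrite (disjointFr newP).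
by move=> /= bT; exists N; rewrite bT in HN.
Qed.

(** Compare [M0] plus the even-rank edges with [N] plus the odd-rank edges: [N] has one edge fewer
    than [M0], which accounts for [c], and misses the ends of [P]. *)
Lemma single_ear_parity c X S : matching_covered K -> ~~ feasible K X ->
  rep H c X S -> odd #|wedges P :&: X| = c (+) odd #|wends P :&: S|.
Proof.
move=> /single_ear_pm[N HN] /(nfeasibleP _ subK) nf repX.
have := nf _ _ (@pm_single false M0 HM0) (@pm_single true N HN).
have sP : wends P \subset verts H by case/and4P: earP.
rewrite !odd_single ?(rep_parity_deficit repX sP HM0 HN); try by case: HM0 HN => ? _ [].
rewrite cards2 (ear_ends_neq earP) /= andbT addbF.
by case: c {repX}; do 4 case: (odd _).
Qed.

Lemma single_ear_rep c X S : matching_covered K -> ~~ feasible K X ->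
  rep H c X S -> exists S', rep K c X S'.
Proof.
move=> covK nf repX; have par := single_ear_parity covK nf repX.
by have [S' _ repS'] := rep_add_walk subH earP repX par; exists S'.
Qed.

(* Adding the first edge of P to X changes the parity of exactly those perfect
   matchings of K that leave the ends of P unmatched in H. *)
Lemma single_ear_lift X N0 : ~~ feasible H X -> pm H (wends P) N0 ->
  (forall M N, pm H (wends P) M -> pm H (wends P) N ->
     odd #|M :&: X| = odd #|N :&: X|) ->
  exists X', ~~ feasible K X' /\ forall e, e \in edges H -> (e \in X') = (e \in X).
Proof.
move=> /(nfeasibleP _ subH) nfH HN0 nfD; have [f fP fb] := ear_first_edge earP.
have fH : f \notin edges H by rewrite (disjointFr newP).
(* The discrepancy in parity between the matchings of [H] and those of [H] without the ends of [P];
   adding [f] exactly when [d] holds compensates for it. *)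
pose d := odd #|M0 :&: X| (+) odd #|N0 :&: X|.
pose X' := X :&: edges H :|: (if d then [set f] else set0).
have fd e : (e \in (if d then [set f] else set0)) = d && (e == f).
  by case: (d); rewrite !inE.
have XX' e : e \in edges H -> (e \in X') = (e \in X).
  move=> eH; rewrite in_setU fd in_setI eH andbT.
  by rewrite (negbTE (contraNneq _ fH : e != f)) ?andbF ?orbF // => <-.
exists X'; split=> //.
have parN N : N \subset edges H -> N :&: X' = N :&: X.
  move=> sN; apply/setP=> e; rewrite !in_setI.
  by case: (boolP (e \in N)) => // /(subsetP sN) /XX'.
have parA b : odd #|alt b (wsteps P) :&: X'| = b && d.
  have -> : alt b (wsteps P) :&: X' = if b && d then [set f] else set0.
    apply/setP=> e; rewrite in_setI in_setU in_setI fd.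
    have -> : e \in (if b && d then [set f] else set0) = [&& b, d & e == f].
      by case: (b); case: (d); rewrite !inE.
    case: (eqVneq e f) => [->|_]; first by rewrite fb (negbTE fH) andbF andbT.
    rewrite !andbF orbF; apply/negbTE/negP=> /and3P[/(subsetP (alt_wedges P b))].
    by move=> /(disjointFr newP)->.
  by case: (_ && _); rewrite ?cards1 ?cards0.
have par M : pm K set0 M -> odd #|M :&: X'| = odd #|M0 :&: X|.
  case/pm_single_inv=> b [N HN ->]; have [sN _] := HN.
  rewrite odd_cardU ?(disjoint_alt b newP sN) // parN // parA.
  case: b HN => HN /=; last by rewrite addbF; apply: nfH.
  by rewrite (nfD _ _ HN HN0) /d addbCA addbb addbF.
by apply/(nfeasibleP _ subK) => M N /par-> /par->.
Qed.

End SingleEar.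
End Ears.

Lemma odd_card_symdiff (T : finType) (A B C : {set T}) :
  odd #|A :&: symdiff B C| = odd #|A :&: B| (+) odd #|A :&: C|.
Proof.
rewrite ![A :&: _]setIC !card_setI_sum !odd_sum -big_split /=.
by apply: eq_bigr => x _; rewrite !inE; case: (x \in B); case: (x \in C).
Qed.

(** * Double ears *)

Section DoubleEars.

Variable G : mgraph.
Implicit Types (H : subg G) (S T W Z : {set vertex G}) (X M N : {set edge G}).
Implicit Types (e f : edge G) (x y u v : vertex G) (c b : bool).
Implicit Types (P Q : walk G).

(** All edges of a bipartite graph form the cut of [T], so complementing the constant amounts to
    switching at [T]. *)
Lemma rep_switch H X S T : rep H false X S -> rep H false setT T ->
  rep H true X (symdiff S T).
Proof.
move=> repX repT e eH; rewrite (repX e eH) odd_card_symdiff.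
by have := repT e eH; rewrite inE /= => <-; rewrite addbT negbK.
Qed.

Lemma rep_setT H : rep H true setT set0.
Proof. by move=> e _; rewrite setI0 cards0 inE. Qed.

(** All perfect matchings have the same size. If every non-feasible set is a cut, this set yields a
    bipartition. *)
Lemma nfeasible_setT H : is_subgraph H -> ~~ feasible H setT.
Proof.
move=> subH; apply/(nfeasibleP _ subH) => M N [_ MV] [_ NV]; rewrite !setIT.
by rewrite -[#|M|]doubleK -(covers_card MV) (covers_card NV) doubleK.
Qed.

Lemma rep_sub_walk H P c X S : rep (add_walk H P) c X S -> rep H c X S.
Proof. by move=> repX e eH; apply: repX; rewrite inE eH. Qed.

Lemma single_ear_step H P M0 X : is_subgraph H -> single_ear H P ->
  pm H set0 M0 -> matching_covered (add_walk H P) ->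
  ~~ feasible (add_walk H P) X -> ~~ feasible H X /\
  forall c S, rep H c X S -> exists S', rep (add_walk H P) c X S'.
Proof.
move=> subH earP HM0 covK nf.
case: (ear_new_or_trivial subH earP) => [newP | eqH].
  split; first exact: nfeasible_single subH earP newP _ nf.
  by move=> c S; apply: (single_ear_rep subH earP newP HM0).
by rewrite eqH in nf *; split=> // c S; exists S.
Qed.

(** In a bipartite enlargement the ends of the odd path [P] would have different colours; then [H]
    would have a matching missing just these ends, and adding [P] would give a matching-covered
    graph. *)
Lemma nonbip_single_ear H P M0 T : is_subgraph H -> matching_covered H ->
  single_ear H P -> pm H set0 M0 -> ~~ matching_covered (add_walk H P) ->
  ~ rep (add_walk H P) false setT T.
Proof.
move=> subH covH earP HM0 /negP ncov repT; apply: ncov.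
have := rep_add_walk_sum earP repT.
rewrite (rep_add_walk_sum earP (@rep_setT _)) setI0 cards0 /= => /esym oddP.
have [N HN] := bip_pm_ear subH covH (rep_sub_walk repT) HM0 earP oddP.
exact: (matching_covered_single subH earP HM0 covH HN).
Qed.

Section DoubleEar.

Variables (H : subg G) (P Q : walk G) (M0 : {set edge G}).
Hypotheses (subH : is_subgraph H) (covH : matching_covered H).
Hypotheses (earPQ : double_ear H P Q) (HM0 : pm H set0 M0).
Hypotheses (newP : [disjoint wedges P & edges H]).
Hypotheses (newQ : [disjoint wedges Q & edges H]).

Let earP : single_ear H P. Proof. by case/and3P: earPQ. Qed.
Let earQ : single_ear H Q. Proof. by case/and3P: earPQ. Qed.
Let dPQ : [disjoint wverts P & wverts Q]. Proof. by case/and3P: earPQ. Qed.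

Let H1 := add_walk H P.
Let K := add_walk H1 Q.

Let subH1 : is_subgraph H1. Proof. exact: is_subgraph_add_walk earP. Qed.

Let earQ1 : single_ear H1 Q.
Proof.
case/and4P: earQ => pathQ oddQ sQ dQ; apply/and4P; split=> //.
  exact: subset_trans sQ (subsetUl _ _).
apply/pred0P=> v /=; apply/negP=> /andP[vQ /setUP[vH | vP]].
  by rewrite (disjointFr dQ vQ) in vH.
by move: vQ; rewrite inE (disjointFr dPQ vP) andbF.
Qed.

Let newQ1 : [disjoint wedges Q & edges H1].
Proof.
apply/pred0P=> e /=; apply/negP=> /andP[eQ /setUP[eH | eP]].
  by rewrite (disjointFr newQ eQ) in eH.
have [x xe] := ends_neq0 e; have xP := wedges_ends earP eP xe.
by have := wedges_ends earQ eQ xe; rewrite (disjointFr dPQ xP).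
Qed.

Let subK : is_subgraph K. Proof. exact: is_subgraph_add_walk earQ1. Qed.

(** The vertices of [H] left to the ears, [b1] and [b2] telling whether the odd-rank edges of [P]
    and of [Q] are used. [Q], added last, is removed first. *)
Definition double_ends b1 b2 : {set vertex G} :=
  (if b2 then wends Q else set0) :|: (if b1 then wends P else set0).

Lemma double_endsQ b : ((if b then wends Q else set0) \subset verts H) &&
  [disjoint (if b then wends Q else set0) & wverts P].
Proof.
case: b; last by rewrite sub0set -setI_eq0 set0I eqxx.
case/and4P: (earQ) => _ _ -> _ /=; apply/pred0P=> v /=; apply/negP.
by case/andP=> /(ear_ends_sub earQ)/andP[vQ _] vP; rewrite (disjointFr dPQ vP) in vQ.
Qed.

Lemma pm_double b1 b2 N : pm H (double_ends b1 b2) N ->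
  pm K set0 (N :|: alt b1 (wsteps P) :|: alt b2 (wsteps Q)).
Proof.
have /andP[sQ dQ] := double_endsQ b2.
by move=> HN; apply: pm_single => //; apply: pm_add_walk.
Qed.

Lemma pm_double_inv M : pm K set0 M -> exists b1 b2, exists2 N,
  pm H (double_ends b1 b2) N & M = N :|: alt b1 (wsteps P) :|: alt b2 (wsteps Q).
Proof.
case/(pm_single_inv subH1 earQ1) => b2 [N1 HN1 ->].
have /andP[sQ dQ] := double_endsQ b2.
have [b1 [N HN ->]] := pm_add_walk_inv subH earP sQ dQ HN1.
by exists b1, b2, N.
Qed.

Lemma odd_double b1 b2 N X : N \subset edges H ->
  odd #|(N :|: alt b1 (wsteps P) :|: alt b2 (wsteps Q)) :&: X| =
    odd #|N :&: X| (+) odd #|alt b1 (wsteps P) :&: X|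
      (+) odd #|alt b2 (wsteps Q) :&: X|.
Proof.
move=> sN; rewrite !odd_cardU ?(disjoint_alt b1 newP sN) //.
by apply: disjoint_alt newQ1 _; apply: setUSS sN (alt_wedges _ _).
Qed.

(** The error in the equation needed to extend a representation along [R]: it is false exactly when
    the equation holds. *)
Definition defect c X S (R : walk G) :=
  odd #|wedges R :&: X| (+) c (+) odd #|wends R :&: S|.

(** Compare the extension of [N] with that of [M0] by the even-rank edges of both paths. The
    difference is the sum of the defects of the paths whose odd-rank edges are used. *)
Lemma double_ear_parity c X S b1 b2 N : ~~ feasible K X -> rep H c X S ->
  pm H (double_ends b1 b2) N ->
  (b1 && defect c X S P) = (b2 && defect c X S Q).
Proof.
move=> /(nfeasibleP _ subK) nf repX HN.
have HM : pm H (double_ends false false) M0 by rewrite /double_ends setU0.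
have := nf _ _ (pm_double HM) (pm_double HN).
have sPQ : double_ends b1 b2 \subset verts H.
  rewrite subUset; have /andP[-> _] := double_endsQ b2.
  by case: (b1); rewrite ?sub0set //; case/and4P: earP.
have dQP : [disjoint if b2 then wends Q else set0 & if b1 then wends P else set0].
  have /andP[_ d] := double_endsQ b2; apply: disjointWr d.
  case: (b1); rewrite ?sub0set //; apply/subsetP=> v.
  by case/(ear_ends_sub earP)/andP.
have oddPQ (X1 : {set vertex G}) : odd #|double_ends b1 b2 :&: X1| =
    (b2 && odd #|wends Q :&: X1|) (+) (b1 && odd #|wends P :&: X1|).
  by rewrite odd_cardU //; case: (b1); case: (b2); rewrite ?set0I ?cards0.
have half : odd #|double_ends b1 b2|./2 = b1 (+) b2.
  rewrite cardsU (_ : _ :&: _ = set0) ?cards0 ?subn0; last first.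
    by apply/eqP; rewrite setI_eq0.
  by case: (b1); case: (b2);
     rewrite ?cards0 ?cards2 ?(ear_ends_neq earP) ?(ear_ends_neq earQ).
rewrite !odd_double; try by case: HM HN => ? _ [].
rewrite (rep_parity_deficit repX sPQ HM0 HN) half oddPQ.
rewrite (odd_alt b1 X earP) (odd_alt b2 X earQ) /defect.
move: (odd #|M0 :&: X|) (odd #|alt false (wsteps P) :&: X|)
  (odd #|alt false (wsteps Q) :&: X|) (odd #|wedges P :&: X|)
  (odd #|wedges Q :&: X|) (odd #|wends P :&: S|) (odd #|wends Q :&: S|).
by case: (b1) (b2) (c) => [] [] [] [] [] [] [] [] [] [].
Qed.

Lemma double_ear_rep c X S : rep H c X S -> defect c X S P = false ->
  defect c X S Q = false -> exists S', rep K c X S'.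
Proof.
move=> repX /negbT; rewrite /defect -addbA negb_add => /eqP dP.
move=> /negbT; rewrite -addbA negb_add => /eqP dQ.
have [S1 agr repS1] := rep_add_walk subH earP repX dP.
have [|S2 _ repS2] := rep_add_walk subH1 earQ1 repS1; last by exists S2.
rewrite dQ; congr (_ (+) odd _); apply: eq_card => v; rewrite !in_setI.
case: (boolP (v \in wends Q)) => //= /(ear_ends_sub earQ)/andP[_ vH].
by rewrite agr.
Qed.

(** The hypothesis on [H] makes it bipartite. Each path is used by some perfect matching, which
    makes the two defects equal; if both are true, each path has ends of one colour, and the
    constant [true] works instead. *)
Lemma double_ear_step X : matching_covered K ->
  (forall Y, ~~ feasible H Y -> exists S, rep H false Y S) ->
  ~~ feasible K X -> exists c S, rep K c X S.
Proof.
move=> covK triv nf.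
have nfH : ~~ feasible H X.
  apply: nfeasible_single earP newP _ _ => //.
  exact: nfeasible_single earQ1 newQ1 _ nf.
have [S repX] := triv X nfH; have [T repT] := triv _ (nfeasible_setT subH).
have par b1 b2 N := @double_ear_parity false X S b1 b2 N nf repX.
have patP : exists b N, pm H (double_ends true b) N.
  have [f fP fb] := ear_first_edge earP.
  have fK : f \in edges K by rewrite !inE in fP *; rewrite fP orbT.
  have [M HM fM] := covered_edge subK covK fK.
  have [b1 [b2 [N HN eM]]] := pm_double_inv HM; exists b2, N.
  suff <- : b1 = true by [].
  rewrite -(fb b1); move: fM; rewrite eM !in_setU => /orP[/orP[]|] //.
    by case: HN => /subsetP sN _ /sN; rewrite (disjointFr newP).
  move/(subsetP (alt_wedges _ _)) => /(disjointFr newQ1).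
  by rewrite inE fP orbT.
have patQ : exists b N, pm H (double_ends b true) N.
  have [f fP fb] := ear_first_edge earQ.
  have fK : f \in edges K by rewrite inE fP orbT.
  have [M HM fM] := covered_edge subK covK fK.
  have [b1 [b2 [N HN eM]]] := pm_double_inv HM; exists b1, N.
  suff <- : b2 = true by [].
  rewrite -(fb b2); move: fM; rewrite eM in_setU => /orP[] //.
  have : f \notin edges H1 by rewrite (disjointFr newQ1).
  move=> fH1 fN; case/negP: fH1; apply: subsetP fN.
  by case: HN => sN _; apply: setUSS sN (alt_wedges _ _).
(* Ends of different colours can be removed alone, giving a matching that uses the odd-rank edges of
   [P] but not those of [Q]. *)
have splitP : odd #|wends P :&: T| -> defect false X S P = false.
  case/(bip_pm_ear subH covH repT HM0 earP) => N HN.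
  by apply: (par true false N); rewrite /double_ends set0U.
have splitQ : odd #|wends Q :&: T| -> defect false X S Q = false.
  case/(bip_pm_ear subH covH repT HM0 earQ) => N HN.
  by apply/esym/(par false true N); rewrite /double_ends setU0.
have eqPQ : defect false X S P = defect false X S Q.
  have [b2 [N2 /par /= eP]] := patP; have [b1 [N1 /par /= eQ]] := patQ.
  by case: b1 b2 eP eQ => [] [] //= -> <-.
case: (boolP (defect false X S P)) => dP; last first.
  exists false; apply: double_ear_rep repX _ _; first exact: negbTE.
  by rewrite -eqPQ; apply: negbTE.
(* When the ends have equal colours, switching at [T] keeps the parity of the ends in the set while
   [c] flips, so the defect vanishes. *)
exists true; apply: double_ear_rep (rep_switch repX repT) _ _.
  move: dP (splitP); rewrite /defect odd_card_symdiff; case: (odd #|_ :&: T|).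
    by move=> dP /(_ isT); rewrite dP.
  by rewrite !addbF addbT addNb => ->.
move: dP (splitQ); rewrite eqPQ /defect odd_card_symdiff; case: (odd #|_ :&: T|).
  by move=> dP /(_ isT); rewrite dP.
by rewrite !addbF addbT addNb => ->.
Qed.

(* Neither ear can be used without the other, so the pair formed by one edge
   of odd rank of each ear meets every perfect matching evenly. *)
Lemma double_ear_Nstar : (forall T, ~ rep H false setT T) ->
  ~~ matching_covered H1 -> ~~ matching_covered (add_walk H Q) ->
  Nstar K <> set0.
Proof.
move=> nonbip ncovP ncovQ /(Nstar0P subK) triv.
have [f fP fb] := ear_first_edge earP; have [g gQ gb] := ear_first_edge earQ.
have fg : f != g.
  by apply: contraTneq fP => ->; apply: contraL gQ => gP; rewrite (disjointFl newQ1) // inE gP orbT.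
have fH : f \notin edges H by rewrite (disjointFr newP).
have gH : g \notin edges H by rewrite (disjointFr newQ).
have fQ b : f \notin alt b (wsteps Q).
  apply: contraL fP => /(subsetP (alt_wedges _ _)) fQ.
  by apply: contraFN (disjointFr newQ1 fQ) => fP; rewrite inE fP orbT.
have gP b : g \notin alt b (wsteps P).
  apply: contraL gQ => /(subsetP (alt_wedges _ _)) gP.
  by rewrite (disjointFl newQ1) // inE gP orbT.
have nf : ~~ feasible K [set f; g].
  have par M : pm K set0 M -> odd #|M :&: [set f; g]| = false.
    case/pm_double_inv=> b1 [b2 [N HN ->]].
    have fN : f \in N = false by case: HN => /subsetP sN _; apply: contraNF fH => /sN.
    have gN : g \in N = false by case: HN => /subsetP sN _; apply: contraNF gH => /sN.
    rewrite setIC odd_card_setI2 // !in_setU fN gN fb gb (negbTE (fQ _)) (negbTE (gP _)).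
    (* If exactly one path is used, adding that path alone gives a matching-covered graph, which is
       excluded. *)
    rewrite orbF /=; case: b1 b2 HN => [] [] //; rewrite /double_ends ?set0U ?setU0 => HN.
      by case/negP: ncovP; apply: (matching_covered_single subH earP HM0 covH HN).
    by case/negP: ncovQ; apply: (matching_covered_single subH earQ HM0 covH HN).
  by apply/(nfeasibleP _ subK) => M N /par-> /par->.
have [c [S repX]] := triv _ nf.
have repH := rep_sub_walk (rep_sub_walk repX).
have notX e : e \in edges H -> e \in [set f; g] = false.
  move=> eH; rewrite !inE; apply/negbTE; rewrite negb_or.
  by apply/andP; split; apply: contraTneq eH => ->.
(* No edge of [H] is in the set, so with [c] true every edge of [H] has exactly one end in [S], a
   bipartition. *)
case: c repX repH => repX repH.
  by apply: (nonbip S) => e eH; have := repH e eH; rewrite notX // inE => /esym/negbFE->.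
(* With [c] false, [S] is closed under adjacency, so by connectivity it contains both ends of [P] or
   neither and [P] should meet the set evenly; yet [P] contains [f] and not [g]. *)
have clos : closed (adjacent H) (mem S).
  move=> x y /existsP[e /andP[eH /eqP ee]].
  have xy : x != y.
    by have := card_ends e; rewrite ee cards2; case: (x != y).
  have := repH e eH; rewrite notX // ee odd_card_setI2 //=.
  by move=> /esym/negbT; rewrite negb_add => /eqP xyS; apply: xyS.
have /andP[_ sH] := ear_ends_sub earP (set21 (wstart P) (wend P)).
have /andP[_ eH] := ear_ends_sub earP (set22 (wstart P) (wend P)).
have con : connect (adjacent H) (wstart P) (wend P).
  by case/andP: covH => /andP[_ /forall_inP/(_ _ sH)/forall_inP/(_ _ eH)].
have := rep_add_walk_sum earP (rep_sub_walk repX).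
rewrite odd_card_setI2 ?(ear_ends_neq earP) //.
have -> : (wstart P \in S) = (wend P \in S) := closed_connect clos con.
rewrite addbb setIC odd_card_setI2 // fP.
suff -> : g \in wedges P = false by [].
by apply: contraTF gQ => gP'; rewrite (disjointFl newQ1) // inE gP' orbT.
Qed.

End DoubleEar.
End DoubleEars.

(** * Ear decompositions *)

Section Decomposition.

Variables (G : mgraph) (r : nat) (Gs : nat -> subg G) (a : nat -> ear G).
Hypothesis dec : ear_decomposition r Gs a.

Let subG i : i <= r -> is_subgraph (Gs i). Proof. exact: ear_dec_subgraph dec i. Qed.
Let covG i : i <= r -> matching_covered (Gs i). Proof. exact: ear_dec_covered dec i. Qed.

(** The excess of [nb_sum i] over [i] is the number of double ears among the first [i] ears. *)
Definition nb_sum i := \sum_(1 <= k < i.+1) nb_ears (a k).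

Lemma nb_sumS i : nb_sum i.+1 = nb_sum i + nb_ears (a i.+1).
Proof. by rewrite /nb_sum big_nat_recr. Qed.

Lemma nb_sum_ge i : i <= nb_sum i.
Proof.
elim: i => // i IH; rewrite nb_sumS; case: (a i.+1) => [P | P Q] /=.
  by rewrite addn1.
by rewrite addn2 ltnW.
Qed.

Lemma dec_pm i : i <= r -> exists M, pm (Gs i) set0 M.
Proof.
move=> ir; suff [e eG] : exists e, e \in edges (Gs i).
  by have [M HM _] := covered_edge (subG ir) (covG ir) eG; exists M.
elim: i ir => [|i IH] ir.
  case/and3P: (ear_dec_K2 dec) => _ _ /cards1P[e ee].
  by exists e; rewrite ee inE.
have [e eG] := IH (ltnW ir); exists e; rewrite (ear_dec_add dec ir).
by case: (a i.+1) => [P | P Q]; rewrite /= !inE eG.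
Qed.

Lemma K2_rep X : exists S, rep (Gs 0) false X S.
Proof.
case/and3P: (ear_dec_K2 dec) => _ _ /cards1P[e ee].
have [x xe] := ends_neq0 e.
exists (if e \in X then [set x] else set0) => f; rewrite ee inE => /eqP-> /=.
case: (e \in X); last by rewrite setI0 cards0.
by rewrite (setIidPr _) ?cards1 // sub1set.
Qed.

Lemma dec_single i P : i < r -> a i.+1 = SingleEar P ->
  single_ear (Gs i) P /\ Gs i.+1 = add_walk (Gs i) P.
Proof.
by move=> ir aP; have := ear_dec_ear dec ir; rewrite (ear_dec_add dec ir) aP.
Qed.

Lemma dec_single_step i P X : i < r -> a i.+1 = SingleEar P ->
  ~~ feasible (Gs i.+1) X -> ~~ feasible (Gs i) X /\
  forall c S, rep (Gs i) c X S -> exists S', rep (Gs i.+1) c X S'.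
Proof.
move=> ir aP; have [earP eG] := dec_single ir aP.
have := covG ir; rewrite eG => covK nf.
have [M0 HM0] := dec_pm (ltnW ir).
exact: (single_ear_step (subG (ltnW ir)) earP HM0 covK nf).
Qed.

Lemma dec_triv_single i P : i < r -> a i.+1 = SingleEar P ->
  Nstar (Gs i) = set0 -> Nstar (Gs i.+1) = set0.
Proof.
move=> ir aP /(Nstar0P (subG (ltnW ir))) triv; apply/(Nstar0P (subG ir)) => X.
case/(dec_single_step ir aP) => /triv[c [S repX]] /(_ c S repX)[S' repX'].
by exists c, S'.
Qed.

Lemma dec_double i P Q : i < r -> a i.+1 = DoubleEar P Q ->
  double_ear (Gs i) P Q /\ Gs i.+1 = add_walk (add_walk (Gs i) P) Q.
Proof.
by move=> ir aPQ; have := ear_dec_ear dec ir; rewrite (ear_dec_add dec ir) aPQ.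
Qed.

(* A double ear may have one of its paths already in G_i, in which case only
   the other path is added. *)
Lemma dec_double_triv i P Q : i < r -> a i.+1 = DoubleEar P Q ->
  (forall X, ~~ feasible (Gs i) X -> exists S, rep (Gs i) false X S) ->
  Nstar (Gs i.+1) = set0.
Proof.
move=> ir aPQ triv; apply/(Nstar0P (subG ir)) => X.
have [earPQ eG] := dec_double ir aPQ; have [M0 HM0] := dec_pm (ltnW ir).
have [earP earQ _] := and3P earPQ.
have subi := subG (ltnW ir); have := covG ir; rewrite eG.
case: (ear_new_or_trivial subi earP) => [newP | ->]; last first.
  move=> covK /(single_ear_step subi earQ HM0 covK)[/triv[S repX]].
  by case/(_ _ _ repX) => S' repX'; exists false, S'.
case: (ear_new_or_trivial subi earQ) => [newQ | eqQ].
  move=> covK; exact: (double_ear_step subi (covG (ltnW ir)) earPQ HM0 newP newQ covK triv).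
have -> : add_walk (add_walk (Gs i) P) Q = add_walk (Gs i) P.
  have /= eqV := congr1 (@verts G) eqQ; have /= eqE := congr1 (@edges G) eqQ.
  by rewrite /add_walk /= setUAC eqV [X in Subg _ X]setUAC eqE.
move=> covK /(single_ear_step subi earP HM0 covK)[/triv[S repX]].
by case/(_ _ _ repX) => S' repX'; exists false, S'.
Qed.

(** There is no double ear so far, and single ears preserve the constant [false] available on
    [K2]. *)
Lemma dec_bip i : i <= r -> nb_sum i <= i ->
  forall X, ~~ feasible (Gs i) X -> exists S, rep (Gs i) false X S.
Proof.
elim: i => [|i IH] ir; first by move=> _ X _; apply: K2_rep.
rewrite nb_sumS; case aE: (a i.+1) => [P | P Q] /=; last first.
  by rewrite addn2 ltnS leqNgt ltnS nb_sum_ge.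
rewrite addn1 ltnS => /(IH (ltnW ir)) triv X.
case/(dec_single_step ir aE) => /triv[S repX] /(_ _ _ repX)[S' repX'].
by exists S'.
Qed.

Lemma dec_triv i : i <= r -> nb_sum i <= i + 1 -> Nstar (Gs i) = set0.
Proof.
elim: i => [|i IH] ir.
  move=> _; apply/(Nstar0P (subG ir)) => X _.
  by have [S repX] := K2_rep X; exists false, S.
rewrite nb_sumS; case aE: (a i.+1) => [P | P Q] /=.
  rewrite !addn1 ltnS => nb; apply: (dec_triv_single ir aE).
  by apply: (IH (ltnW ir)); rewrite addn1.
(* The bound leaves no room for a double ear before this one. *)
rewrite addn2 addn1 !ltnS => /(dec_bip (ltnW ir)) triv.
exact: (dec_double_triv ir aE triv).
Qed.

(** By irreducibility the first path of a double ear already destroys bipartiteness, and larger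
    graphs stay nonbipartite. *)
Lemma dec_nonbip i T : irreducible_double_ears r Gs a -> i <= r ->
  i < nb_sum i -> ~ rep (Gs i) false setT T.
Proof.
move=> irr; elim: i => [|i IH] ir; first by rewrite /nb_sum big_nil.
rewrite nb_sumS; case aE: (a i.+1) => [P | P Q] /=.
  rewrite addn1 ltnS => /(IH (ltnW ir)) nonbip.
  by have [_ ->] := dec_single ir aE => /rep_sub_walk.
have [/and3P[earP _ _] ->] := dec_double ir aE.
have [ncovP _] := irr i P Q ir aE; have [M0 HM0] := dec_pm (ltnW ir).
move=> _ /rep_sub_walk.
exact: nonbip_single_ear (subG (ltnW ir)) (covG (ltnW ir)) earP HM0 ncovP.
Qed.

Lemma dec_double_Nstar i P Q : irreducible_double_ears r Gs a -> i < r ->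
  a i.+1 = DoubleEar P Q -> i < nb_sum i -> Nstar (Gs i.+1) <> set0.
Proof.
move=> irr ir aE nb; have [ncovP ncovQ] := irr i P Q ir aE.
have [earPQ ->] := dec_double ir aE; have [earP earQ _] := and3P earPQ.
have subi := subG (ltnW ir); have covi := covG (ltnW ir).
have [M0 HM0] := dec_pm (ltnW ir).
(* A path already in [Gs i] would leave this matching-covered graph unchanged, against
   irreducibility. *)
have [newP | eqP] := ear_new_or_trivial subi earP; last by rewrite eqP covi in ncovP.
have [newQ | eqQ] := ear_new_or_trivial subi earQ; last by rewrite eqQ covi in ncovQ.
apply: (double_ear_Nstar subi covi earPQ HM0 newP newQ _ ncovP ncovQ) => T.
exact: dec_nonbip irr (ltnW ir) nb.
Qed.

(** A nontrivial [X] that stays non-feasible without the ends of [P] lifts to a nontrivial set of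
    the larger graph. Conversely, a non-feasible set of the larger graph is non-feasible in both
    smaller ones. *)
Lemma dec_single_Nstar i P : i < r -> a i.+1 = SingleEar P ->
  Nstar (Gs i.+1) = set0 <->
  forall X, X \in Nstar (Gs i) ->
    feasible (del_verts (Gs i) (wends P))
      (X :&: edges (del_verts (Gs i) (wends P))).
Proof.
move=> ir aE; have [earP eG] := dec_single ir aE.
have subi := subG (ltnW ir); have covi := covG (ltnW ir).
have [M0 HM0] := dec_pm (ltnW ir).
have newP : [disjoint wedges P & edges (Gs i)].
  case: (ear_new_or_trivial subi earP) => // eqG.
  by case: (ear_dec_strict dec ir); rewrite eG.
have covK := covG ir; have subK := subG ir; rewrite eG in covK subK *.
have [N0 HN0] := single_ear_pm subi earP newP covK.
split=> [/(Nstar0P subK) triv X XN | feasD].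
  have := XN; rewrite inE => /and4P[sX nf _ _].
  apply: contraT => /(nfeasible_del_vertsP _ _ subi) nfD.
  have [X' [nf' agr]] := single_ear_lift subi earP newP HM0 nf HN0 nfD.
  have [c [S repX']] := triv X' nf'.
  case: (elimT (in_Nstar subi sX nf) XN c S) => e eH.
  by rewrite -agr //; apply: rep_sub_walk repX' e eH.
apply/(Nstar0P subK) => X nf.
have [nfH ext] := single_ear_step subi earP HM0 covK nf.
have [[c [S repX]] | XN] := rep_or_Nstar subi nfH.
  by have [S' repX'] := ext c S repX; exists c, S'.
have /negP[] : ~~ ~~ feasible (del_verts (Gs i) (wends P))
    (X :&: edges (Gs i) :&: edges (del_verts (Gs i) (wends P))).
  by rewrite negbK; apply: feasD.
apply/(nfeasible_del_vertsP _ _ subi) => M N HM HN.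
have [[sM _] [sN _]] := (HM, HN).
rewrite ![_ :&: (X :&: _)]setIA ![_ :&: X :&: _]setIAC (setIidPl sM) (setIidPl sN).
have /(nfeasibleP _ subK) nfK := nf.
(* Adding the same odd-rank edges of [P] to both matchings carries the comparison into the larger
   graph. *)
have := nfK _ _ (pm_single earP (b := true) HM)
  (pm_single earP (b := true) HN).
by rewrite !(odd_single earP newP) // => /addIb/addIb.
Qed.

End Decomposition.

Theorem theorem1p4 (G : mgraph) (r : nat) (Gs : nat -> subg G)
    (a : nat -> ear G)
    (r_ge1 : 1 <= r)
    (G_covered : matching_covered (whole G))
    (G_dec : ear_decomposition r Gs a) :
  (* (i) *)
  (Nstar (Gs r.-1) = set0 -> nb_ears (a r) = 1 -> Nstar (whole G) = set0)
  /\
  (* (ii) *)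
  (\sum_(1 <= i < r.+1) nb_ears (a i) <= r + 1 -> Nstar (whole G) = set0)
  /\
  (* (iii) *)
  (irreducible_double_ears r Gs a ->
   r + 2 <= \sum_(1 <= i < r.+1) nb_ears (a i) -> nb_ears (a r) = 2 ->
   Nstar (whole G) <> set0)
  /\
  (* (iv) *)
  (forall P : walk G, a r = SingleEar P ->
   r + 2 <= \sum_(1 <= i < r.+1) nb_ears (a i) ->
   (Nstar (whole G) = set0 <->
    forall X : {set edge G}, X \in Nstar (Gs r.-1) ->
      let H := del_verts (Gs r.-1) (wends P) in
      feasible H (X :&: edges H))).
Proof.
rewrite -(ear_dec_whole G_dec) -/(nb_sum a r).
case: r r_ge1 G_dec {G_covered} => // r _ dec /=.
split; [|split; [|split]].
- case aE: (a r.+1) => [P | //] triv _.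
  exact: (dec_triv_single dec (ltnSn r) aE triv).
- exact: dec_triv dec _ (leqnn _).
- rewrite nb_sumS; case aE: (a r.+1) => [// | P Q] irr nb _.
  apply: (dec_double_Nstar dec irr (ltnSn r) aE).
  (* Subtracting the 2 of the last ear leaves [r < nb_sum a r]: an earlier ear is double. *)
  by move: nb; rewrite /= !addn2 !ltnS.
- by move=> P aE _; apply: (dec_single_Nstar dec (ltnSn r) aE).
Qed.
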